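(* Let $c_n\to c\in(1,\infty)$. Let $V_{1,1}, A_{1,1}$ denote the vertex set and the arc set of the $(1,1)$-core of $D(n,m=c_n n)$, and let $V_1, A_1$ denote the vertex set and arc set of the largest strong component of $D(n,m=c_n n)$. Then, with probability tending to $1$ as $n\to\infty$, $$0 \leq |V_{1,1}| - |V_1| \leq 2(\ln n)^8, \qquad 0 \leq |A_{1,1}|-|A_1| \leq 4 (\ln n )^{10}.$$
   Context: Digraphs have no loops and no multiple arcs (both $(u,v)$ and $(v,u)$ may be present). $D(n,m)$ is uniformly distributed on all digraphs with vertex set $[n]=\{1,\dots,n\}$ and exactly $m$ arcs ($m=c_n n$ an integer). The $(1,1)$-core of a digraph is its maximal subgraph with minimum in-degree and minimum out-degree at least $1$ (possibly empty). A strong component is a maximal strongly connected subgraph; the largest strong component is the one with the most vertices (ties broken arbitrarily). *)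

(* Defs.v *)
From HB Require Import structures.
From mathcomp Require Import all_boot all_order all_algebra.

Set Implicit Arguments.
Unset Strict Implicit.
Unset Printing Implicit Defensive.

Import GRing.Theory.

Section Digraphs.
Variable T : finType.

Definition digraph_axiom (G : {set T} * {set T * T}) : bool :=
  [forall u, forall v,
    ((u, v) \in G.2) ==> [&& u \in G.1, v \in G.1 & u != v]].

(* The vertex set is part of the data, so that subgraphs of a digraph on T are
   again of type digraph T; arcs form a set of ordered pairs, so there are no
   multiple arcs, but opposite arcs (u, v) and (v, u) may both be present. *)
Record digraph := Digraph {
  digraph_val : {set T} * {set T * T};
  _ : digraph_axiom digraph_val }.

HB.instance Definition _ := [isSub for digraph_val].
HB.instance Definition _ := [Finite of digraph by <:].

Definition vertices (G : digraph) : {set T} := (digraph_val G).1.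
Definition arcs (G : digraph) : {set T * T} := (digraph_val G).2.

Definition subdigraph (H G : digraph) : bool :=
  (vertices H \subset vertices G) && (arcs H \subset arcs G).

Definition maximal_subdigraph (P : pred digraph) (G H : digraph) : bool :=
  [&& subdigraph H G, P H &
    [forall K, [&& subdigraph K G, P K & subdigraph H K] ==> (K == H)]].

Definition indegree (G : digraph) (v : T) : nat :=
  #|[set u | (u, v) \in arcs G]|.
Definition outdegree (G : digraph) (v : T) : nat :=
  #|[set w | (v, w) \in arcs G]|.

Definition min_indegree_ge (k : nat) (G : digraph) : bool :=
  [forall v in vertices G, k <= indegree G v].
Definition min_outdegree_ge (k : nat) (G : digraph) : bool :=
  [forall v in vertices G, k <= outdegree G v].

Definition in_out_ge1 (G : digraph) : bool :=
  min_indegree_ge 1 G && min_outdegree_ge 1 G.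

(* The empty digraph satisfies in_out_ge1, so a (1,1)-core always exists; see
   core11_exists and core11_unique. *)
Definition is_core11 : digraph -> digraph -> bool :=
  maximal_subdigraph in_out_ge1.

(* A single vertex without arcs is strongly connected. *)
Definition strongly_connected (G : digraph) : bool :=
  (vertices G != set0) &&
  [forall u in vertices G, forall v in vertices G,
    connect (fun x y => (x, y) \in arcs G) u v].

Definition strong_component : digraph -> digraph -> bool :=
  maximal_subdigraph strongly_connected.

Definition largest_strong_component (G H : digraph) : bool :=
  strong_component G H &&
  [forall K, strong_component G K ==> (#|vertices K| <= #|vertices H|)].

Lemma digraph_eq (G H : digraph) :
  vertices G = vertices H -> arcs G = arcs H -> G = H.
Proof.
move: G H => [[V A] hG] [[W B] hH]; rewrite /vertices /arcs /= => eV eA.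
by apply: val_inj; rewrite /= eV eA.
Qed.

Lemma subdigraph_refl G : subdigraph G G.
Proof. by rewrite /subdigraph !subxx. Qed.

Lemma subdigraph_trans K H G :
  subdigraph H K -> subdigraph K G -> subdigraph H G.
Proof.
move=> /andP[V1 A1] /andP[V2 A2].
by rewrite /subdigraph (subset_trans V1 V2) (subset_trans A1 A2).
Qed.

Lemma maximal_subdigraph_exists (P : pred digraph) G H :
  subdigraph H G -> P H ->
  exists2 K, maximal_subdigraph P G K & subdigraph H K.
Proof.
move=> HG PH.
pose Q K := [&& subdigraph K G, P K & subdigraph H K].
have QH : Q H by rewrite /Q HG PH subdigraph_refl.
case: (arg_maxnP (fun K => #|vertices K| + #|arcs K|) QH) => K.
move=> /and3P[KG PK HK] Kmax; exists K => //.
apply/and3P; split=> //; apply/forallP=> L; apply/implyP=> /and3P[LG PL KL].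
have {Kmax} leLK := Kmax L _; have /andP[sV sA] := KL.
have {}leLK : #|vertices L| + #|arcs L| <= #|vertices K| + #|arcs K|.
  by apply: leLK; rewrite /Q LG PL (subdigraph_trans HK KL).
have cV := subset_leq_card sV; have cA := subset_leq_card sA.
apply/eqP; apply: digraph_eq; apply/esym/eqP; rewrite eqEcard ?sV ?sA /=.
- by rewrite -(leq_add2r #|arcs L|) (leq_trans leLK) ?leq_add2l.
- by rewrite -(leq_add2l #|vertices L|) (leq_trans leLK) ?leq_add2r.
Qed.

Lemma core11_exists G : exists H, is_core11 G H.
Proof.
have ax0 : digraph_axiom (set0, set0).
  by apply/forallP=> u; apply/forallP=> v; rewrite inE.
have [|| H coreH _] :=
  @maximal_subdigraph_exists in_out_ge1 G (Digraph ax0); last by exists H.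
- by rewrite /subdigraph /vertices /arcs /= !sub0set.
- by apply/andP; split; apply/forallP=> v; rewrite /vertices /= inE.
Qed.

Lemma core11_unique G H K : is_core11 G H -> is_core11 G K -> H = K.
Proof.
move=> /and3P[HG /andP[Hi Ho] Hmax] /and3P[KG /andP[Ki Ko] Kmax].
have axU : digraph_axiom (vertices H :|: vertices K, arcs H :|: arcs K).
  apply/forallP=> u; apply/forallP=> v; apply/implyP; rewrite !inE /=.
  case: H K {Hi Ho Hmax Ki Ko Kmax HG KG} => [h hP] [k kP].
  rewrite /vertices /arcs /= => /orP[] uv.
  - by move/forallP/(_ u)/forallP/(_ v)/implyP/(_ uv): hP => /and3P[-> -> ->].
  - move/forallP/(_ u)/forallP/(_ v)/implyP/(_ uv): kP => /and3P[-> -> ->].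
    by rewrite !orbT.
pose U := Digraph axU.
have sHU : subdigraph H U by rewrite /subdigraph !subsetUl.
have sKU : subdigraph K U by rewrite /subdigraph !subsetUr.
have sUG : subdigraph U G.
  by case/andP: HG KG => a b /andP[c d]; rewrite /subdigraph !subUset a b c d.
have PU : in_out_ge1 U.
  apply/andP; split; apply/forallP=> v; apply/implyP; rewrite inE => /orP[] vV.
  - apply: leq_trans (implyP (forallP Hi v) vV) (subset_leq_card _).
    by apply/subsetP=> u; rewrite !inE => ->.
  - apply: leq_trans (implyP (forallP Ki v) vV) (subset_leq_card _).
    by apply/subsetP=> u; rewrite !inE => ->; rewrite orbT.
  - apply: leq_trans (implyP (forallP Ho v) vV) (subset_leq_card _).
    by apply/subsetP=> u; rewrite !inE => ->.
  - apply: leq_trans (implyP (forallP Ko v) vV) (subset_leq_card _).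
    by apply/subsetP=> u; rewrite !inE => ->; rewrite orbT.
move/forallP/(_ U): Hmax; rewrite sUG PU sHU => /eqP <-.
by move/forallP/(_ U): Kmax; rewrite sUG PU sKU => /eqP <-.
Qed.

Lemma largest_strong_component_exists G :
  vertices G != set0 -> exists H, largest_strong_component G H.
Proof.
case/set0Pn=> x xG.
have ax1 : digraph_axiom ([set x], set0).
  by apply/forallP=> u; apply/forallP=> v; rewrite inE.
have [|| H0 scH0 _] :=
  @maximal_subdigraph_exists strongly_connected G (Digraph ax1).
- by rewrite /subdigraph /vertices /arcs /= sub0set sub1set [_ \in _]xG.
- rewrite /strongly_connected; apply/andP; split.
    by apply/set0Pn; exists x; rewrite inE.
  apply/forallP=> u; apply/implyP; rewrite inE => /eqP ->.
  by apply/forallP=> v; apply/implyP; rewrite inE => /eqP ->; exact: connect0.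
case: (arg_maxnP (fun K => #|vertices K|) (scH0 : strong_component G H0)).
move=> H scH Hmax; exists H; rewrite /largest_strong_component scH /=.
by apply/forallP=> K; apply/implyP => /Hmax.
Qed.

End Digraphs.

(* The vertex set [n] is represented by 'I_n = {0, ..., n - 1}. *)
Definition digraphs_nm (n m : nat) : {set digraph 'I_n} :=
  [set G | (vertices G == [set: 'I_n]) && (#|arcs G| == m)].

(* The junk value for m > n * (n - 1), when digraphs_nm n m is empty, is 0. *)
Definition Pr_D (R : fieldType) (n m : nat) (E : pred (digraph 'I_n)) : R :=
  (#|[set G in digraphs_nm n m | E G]|%:R / #|digraphs_nm n m|%:R)%R.

(* Main.v *)
(* Let R+(u) and R-(u) be the sets of vertices reachable from u and reaching u,
   and put l = log_4 n, L = l^2. If R+(u) = S then no arc leaves S and every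
   vertex of S other than u receives an arc from S, so that #|R+(u)| = s has
   at most the probability that a binomial variable of mean about
   n (1 - exp (- c s / n)) takes the value s - 1. By Chernoff's bound #|R+(u)|
   is therefore whp either at most L or at least a constant fraction x n, with
   c (1 - x) < 1. Once R+(u) is that large, backward exploration outside R+(u)
   is subcritical, so whp every u with #|R+(u)| > L reaches every v with
   #|R-(v)| > L. A double count of reachable pairs shows that more than L
   vertices have both sets large, and these form the largest strong component.
   These events are bounded for independent arcs of probability p = m / N,
   N = n (n - 1), at the cost of a factor N + 1, since m is the mode of the
   number of arcs.

   A vertex of the core outside this component has, say, #|R+(v)| <= L, and
   R+(v) contains a cycle, hence a spanning out-tree plus one more arc, while
   no arc leaves it. Directly in D(n,m), the expected number of such vertices is
   at most the sum over s <= L of s^2 (c exp (1 - c))^s, which is O(L^3), so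
   by Markov's inequality there are at most l^8 of them whp. Arcs are controlled
   through the maximum degree, which is whp at most L. *)

Require Import Defs.
From HB Require Import structures.
From mathcomp Require Import all_boot all_order all_algebra.
From mathcomp Require Import zify ring lra.

Set Implicit Arguments.
Unset Strict Implicit.
Unset Printing Implicit Defensive.

(** * Reachability and excess arcs *)

Section Reachability.
Variable T : finType.
Implicit Types (A : {set T * T}) (S X U : {set T}) (u v w x y : T).

Definition arc_rel A : rel T := fun x y => (x, y) \in A.
Definition reach_from A X : {set T} :=
  [set w | [exists x in X, connect (arc_rel A) x w]].
Definition reach A u : {set T} := [set w | connect (arc_rel A) u w].
Definition coreach A v : {set T} := [set x | connect (arc_rel A) x v].
Definition transpose A : {set T * T} := [set e | (e.2, e.1) \in A].

Lemma transposeK : involutive transpose.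
Proof. by move=> A; apply/setP=> -[x y]; rewrite !inE. Qed.

Lemma transpose0 : transpose set0 = set0.
Proof. by apply/setP=> e; rewrite !inE. Qed.

Lemma connect_transpose A x y :
  connect (arc_rel (transpose A)) x y = connect (arc_rel A) y x.
Proof.
have /= <- := connect_rev (arc_rel A) x y.
by apply: eq_connect => u v; rewrite /arc_rel inE.
Qed.

Lemma coreach_transpose A v : coreach A v = reach (transpose A) v.
Proof. by apply/setP=> x; rewrite !inE connect_transpose. Qed.

Lemma reach_from1 A u : reach_from A [set u] = reach A u.
Proof.
apply/setP=> w; rewrite !inE; apply/existsP/idP => [[x]|cuw].
  by rewrite inE => /andP[/eqP->].
by exists u; rewrite inE eqxx.
Qed.

Lemma sub_reach_from A X : X \subset reach_from A X.
Proof.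
by apply/subsetP=> x xX; rewrite inE; apply/existsP; exists x; rewrite xX connect0.
Qed.

Lemma reach_fromU A X Y :
  reach_from A (X :|: Y) = reach_from A X :|: reach_from A Y.
Proof.
apply/setP=> w; rewrite !inE; apply/existsP/orP=> [[x]|].
  rewrite inE => /andP[/orP[xX|xY] cxw]; [left|right];
  by apply/existsP; exists x; apply/andP.
case=> /existsP[x /andP[xX cxw]]; exists x; rewrite inE xX cxw ?orbT //.
Qed.

Lemma connect_last A x w : connect (arc_rel A) x w -> x != w ->
  exists2 z, connect (arc_rel A) x z & (z, w) \in A.
Proof.
case/connectP; elim/last_ind=> [|p z _] /=; first by move=> _ ->; rewrite eqxx.
rewrite rcons_path last_rcons => /andP[pp ez] -> _.
by exists (last x p) => //; apply/connectP; exists p.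
Qed.

Lemma reach_from_arc A X w : w \notin X ->
  (w \in reach_from A X) = [exists x in reach_from A X, (x, w) \in A].
Proof.
move=> wX; rewrite {1}inE; apply/existsP/existsP=> [[x /andP[xX cxw]]|[x]].
  case: (connect_last cxw) => [|z cxz zw].
    by apply: contra wX => /eqP<-.
  by exists z; rewrite inE zw andbT; apply/existsP; exists x; apply/andP.
rewrite inE => /andP[/existsP[z /andP[zX czx]] xw]; exists z; rewrite zX.
by apply: connect_trans czx (connect1 _).
Qed.

(** Whether [w] lies in the reachable set [S] is decided by the arcs from [S] to [w] alone. For
    fixed [S] these blocks are disjoint for distinct [w], which later becomes independence. *)
Lemma reach_from_block A X w : w \notin X ->
  (A :&: setX (reach_from A X) [set w] == set0) = (w \notin reach_from A X).
Proof.
move=> wX; apply/idP/idP=> [/eqP e0|].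
  apply/negP; rewrite reach_from_arc // => /existsP[x /andP[xS xw]].
  by move/setP/(_ (x, w)): e0; rewrite in_setI in_setX in_set1 xw xS eqxx in_set0.
apply: contraR => /set0Pn[[x y]]; rewrite !in_setI in_setX in_set1 /= => /and3P[xy xS /eqP yw].
by rewrite reach_from_arc //; apply/existsP; exists x; rewrite xS -yw.
Qed.

Lemma reachxx A u : u \in reach A u.
Proof. by rewrite inE connect0. Qed.

Lemma coreachxx A u : u \in coreach A u.
Proof. by rewrite inE connect0. Qed.

Lemma coreach_block A v x : x != v ->
  (A :&: setX [set x] (coreach A v) == set0) = (x \notin coreach A v).
Proof.
move=> xv; rewrite coreach_transpose -reach_from1 -reach_from_block ?inE //.
set S := reach_from _ _.
have -> : A :&: setX [set x] S = transpose (transpose A :&: setX S [set x]).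
  apply/setP=> -[a b]; rewrite !(in_set, in_setI, in_setX, in_set1) /=; by rewrite [(a == x) && _]andbC.
by rewrite -(inj_eq (can_inj transposeK)) transposeK transpose0.
Qed.

End Reachability.

Section Excess.
Variables (T : finType).
Implicit Types (A : {set T * T}) (S U : {set T}) (v : T).

(** Breadth-first tree: [d] is the distance from [v], and [f w] precedes [w] on a shortest path. The
    growth of [d] along tree arcs will tell an extra arc from a tree arc. *)
Lemma reach_tree A v : exists (f : T -> T) (d : T -> nat),
  forall w, w \in reach A v -> w != v ->
    [/\ f w \in reach A v, (f w, w) \in A & d (f w) < d w].
Proof.
pose Q w k := [exists p : k.-tuple T, path (arc_rel A) v p && (last v p == w)].
pose d w := find (Q w) (iota 0 #|T|).
have dQ w k : Q w k -> d w <= k.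
  move=> Qk; rewrite leqNgt; apply/negP=> kd.
  have := before_find 0 kd; rewrite nth_iota ?add0n ?Qk //.
  by rewrite (leq_trans kd) // (leq_trans (find_size _ _)) ?size_iota.
have Qd w : w \in reach A v -> Q w (d w).
  rewrite inE => /connectP[p0 pp0 lp0].
  case: (shortenP pp0) lp0 => p pp up _ lp.
  have Qp : Q w (size p).
    by apply/existsP; exists (in_tuple p); rewrite /= pp -lp eqxx.
  have hasQ : has (Q w) (iota 0 #|T|).
    apply/hasP; exists (size p) => //; rewrite mem_iota add0n /=.
    by have := uniq_leq_size up (fun x _ => mem_enum T x); rewrite -cardT.
  have := nth_find 0 hasQ; rewrite nth_iota ?add0n //.
  by rewrite -{2}(size_iota 0 #|T|) -has_find.
(* The implications make this true for every [w], with [v] as default witness, so that [xchoose]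
   gives a total parent map. *)
have ex w : exists z, (w \in reach A v) ==> (w != v) ==>
    [&& z \in reach A v, (z, w) \in A & d z < d w].
  case: (boolP (w \in reach A v)) => [wS|]; last by exists v.
  case: (eqVneq w v) => [->|wv]; first by exists v.
  have /existsP[[p /= /eqP sp] /andP[pp /eqP lp]] := Qd _ wS.
  case/lastP: p => [|p z] in sp pp lp; first by rewrite /= in lp; rewrite lp eqxx in wv.
  rewrite last_rcons in lp; rewrite lp {lp z} rcons_path size_rcons in sp pp.
  case/andP: pp => pp lw; exists (last v p); rewrite inE; apply/and3P; split=> //.
    by apply/connectP; exists p.
  rewrite -sp ltnS; apply: dQ; apply/existsP; exists (in_tuple p) => /=.
  by rewrite pp eqxx.
exists (fun w => xchoose (ex w)), d => w wS wv.
by have /implyP/(_ wS)/implyP/(_ wv)/and3P := xchooseP (ex w).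
Qed.

Definition tree_arcs v S (f : T -> T) : {set T * T} :=
  [set (f w, w) | w in S :\ v].

Lemma card_tree_arcs v S f : v \in S -> (#|tree_arcs v S f|).+1 = #|S|.
Proof.
move=> vS; rewrite /tree_arcs card_in_imset => [|x y _ _ [_ //]].
by rewrite (cardsD1 v S) vS.
Qed.

(* The [#|S|] arcs [e |: tree_arcs v S f] lie inside [S], and no arc leaves
   [S]. *)
Definition excess_witness A L v S (f : {ffun T -> T}) (e : T * T) : bool :=
  [&& v \in S, #|S| <= L, f \in pffun_on v (mem (S :\ v)) (mem S),
      e \in setX S S, e \notin tree_arcs v S f,
      e |: tree_arcs v S f \subset A & [disjoint A & setX S (~: S)]].

Definition has_excess A L v : bool :=
  [exists S, exists f, exists e, excess_witness A L v S f e].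

(** Take a vertex [x] of [S] and [U] at maximal depth. Its arc to some [y] in [U] stays in [S] and
    does not increase the depth, so it is not a tree arc. *)
Lemma endless_has_excess A L U v :
    {in U, forall x, exists2 y, y \in U & (x, y) \in A} ->
  v \in U -> #|reach A v| <= L -> has_excess A L v.
Proof.
move=> outU vU leL; have [f [d fd]] := reach_tree A v.
set S := reach A v in fd leL *.
have vS : v \in S by exact: reachxx.
have closedS x y : x \in S -> (x, y) \in A -> y \in S.
  by rewrite !inE => cx xy; apply: connect_trans cx (connect1 _).
(* The default value [v] off [S :\ v] places [f'] in the finite family counted by [pffun_on]. *)
pose f' : {ffun T -> T} := [ffun w => if w \in S :\ v then f w else v].
have treef' : tree_arcs v S f' = tree_arcs v S f.
  by apply: eq_in_imset => w wS; rewrite ffunE wS.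
have vSU : v \in S :&: U by rewrite inE vS.
case: (@arg_maxnP _ v [in S :&: U] d vSU) => x /setIP[xS xU] xmax.
have [y yU xy] := outU x xU.
have yS := closedS _ _ xS xy.
have dyx : d y <= d x by apply: xmax; apply/setIP.
have eN : (x, y) \notin tree_arcs v S f.
  apply/imsetP=> -[w]; rewrite !inE => /andP[wv wS] [xw yw].
  have := fd w; rewrite inE => /(_ wS wv)[_ _]; rewrite -xw -yw => lt.
  by have := leq_trans lt dyx; rewrite ltnn.
apply/existsP; exists S; apply/existsP; exists f'; apply/existsP; exists (x, y).
rewrite /excess_witness vS leL treef' eN in_setX xS yS /=; apply/and3P; split.
- apply/pffun_onP; split.
    apply/subsetP=> w; rewrite inE /= ffunE; case: ifP => //.
    by rewrite eqxx.
  move=> z /imageP[w]; rewrite /= => wS ->; rewrite ffunE [w \in S :\ v]wS.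
  by move: wS; rewrite !inE => /andP[wv wS]; have [] := fd w; rewrite ?inE.
- apply/subsetP=> e; rewrite in_setU1 => /predU1P[-> //|/imsetP[w]].
  by rewrite in_setD1 => /andP[wv wS] ->; have [] := fd w wS wv.
- rewrite disjoint_subset; apply/subsetP=> -[a b] ab; rewrite !inE /=.
  apply/negP=> /andP[aS /negP]; apply.
  by have := closedS a b; rewrite !inE; apply.
Qed.

End Excess.

(** * The largest strong component under deterministic conditions *)

Lemma leq_card_bigcup (I T : finType) (P : pred I) (F : I -> {set T}) :
  #|\bigcup_(i | P i) F i| <= \sum_(i | P i) #|F i|.
Proof.
elim/big_rec2: _ => [|i m X _ leX]; first by rewrite cards0.
by rewrite (leq_trans (leq_card_setU _ _)) // leq_add2l.
Qed.

Lemma arcs_vertices (T : finType) (H : digraph T) x y : (x, y) \in arcs H ->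
  [/\ x \in vertices H, y \in vertices H & x != y].
Proof.
by case: H => -[V E] ax xy; have /forallP/(_ x)/forallP/(_ y)/implyP/(_ xy)/and3P := ax.
Qed.

(** Only the prefixes of one fixed enumeration are used, so a union bound over them has just
    [#|T|.+1] terms. *)
Definition initial_set (T : finType) (k : nat) : {set T} :=
  [set x in take k (enum T)].

Section Giant.
Variables (T : finType) (G : digraph T) (L s0 M : nat).
Let A := arcs G.

Hypothesis GT : vertices G = setT.
Hypothesis gap1 : forall u, L < #|reach A u| -> s0 <= #|reach A u|.
Hypothesis gap_initial : forall k, #|reach_from A (initial_set T k)| < s0 ->
  #|reach_from A (initial_set T k)| <= L.
Hypothesis link : forall u v,
  s0 <= #|reach A u| -> L < #|coreach A v| -> v \in reach A u.
Hypothesis outdeg : forall v, outdegree G v <= L.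
Hypothesis indeg : forall v, indegree G v <= L.
Hypothesis few_excess : #|[set v | has_excess A L v]| <= M.
Hypothesis few_excess_tr : #|[set v | has_excess (transpose A) L v]| <= M.
Hypothesis L_gt0 : 0 < L.
Hypothesis s0_large : (1 + L * L) * (2 * L) < s0.
Hypothesis s0_le : s0 <= #|T|.

(** [B] will turn out to be the vertex set of the largest strong component. *)
Let P := [set u | L < #|reach A u|].
Let Q := [set v | L < #|coreach A v|].
Let B := P :&: Q.

(* Adding the vertices one at a time, the reachable set grows by at most [L] at
   each step if no vertex reaches more than [L] others; it would then stop in
   the gap between [L] and [s0]. *)
Lemma exists_far_reaching : exists u, u \in P.
Proof.
case: (set_0Vmem P) => [P0|[u]]; last by exists u.
have leL u : #|reach A u| <= L.
  by rewrite leqNgt; apply/negP=> uP; have := in_set0 u; rewrite -P0 inE uP.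
have leLk k : k <= #|T| -> #|reach_from A (initial_set T k)| <= L.
  elim: k => [_|k IHk ltk].
    rewrite (_ : reach_from _ _ = set0) ?cards0 //; apply/setP=> w.
    by rewrite !inE; apply/existsP=> -[x]; rewrite !inE take0.
  apply: gap_initial; have /card_gt0P[x0 _] : 0 < #|T| by apply: leq_ltn_trans ltk.
  have -> : initial_set T k.+1 = initial_set T k :|: [set nth x0 (enum T) k].
    apply/setP=> x; rewrite !inE (take_nth x0) -?cardT // mem_rcons inE.
    by rewrite orbC.
  rewrite reach_fromU reach_from1 (leq_ltn_trans (leq_card_setU _ _)) //.
  apply: leq_ltn_trans s0_large.
  rewrite (leq_trans (leq_add (IHk (ltnW ltk)) (leL _))) //; lia.
have := leLk _ (leqnn _); rewrite /initial_set take_oversize ?cardT //.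
have -> : #|reach_from A [set x in enum T]| = size (enum T); last rewrite -cardT.
  rewrite -cardT -cardsT; congr #|pred_of_set _|; apply/setP=> x; rewrite in_setT.
  by apply: (subsetP (sub_reach_from _ _)); rewrite inE mem_enum.
by move=> TL; have := leq_trans s0_le TL; move: s0_large; nia.
Qed.

(* A path leaving [P] does so through one of at most [L] arcs from a vertex of
   [P], to a vertex that reaches at most [L] others. *)
Lemma reach_in_far_reaching u : u \in P ->
  s0 <= (1 + L * L) * #|reach A u :&: P|.
Proof.
move=> uP; set W := reach A u :&: P.
have sub : reach A u \subset
    W :|: \bigcup_(x in W) \bigcup_(y | ((x, y) \in A) && (y \notin P)) reach A y.
  (* The induction along a path generalises its start to any vertex of [W]; the first vertex outside
     [P] settles the claim. *)
  have uW : u \in W by rewrite inE reachxx.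
  apply/subsetP=> z; rewrite {1}inE => /connectP[p]; move: {1 2 3}u uW => x.
  elim: p x => [|y p IHp] x xW /=.
    by move=> _ ->; rewrite inE xW.
  case/andP=> xy yp zl; have yW : y \in reach A u.
    have /setIP[xR _] := xW; have cux : connect (arc_rel A) u x by rewrite inE in xR.
    by rewrite inE; apply: connect_trans cux (connect1 _).
  case: (boolP (y \in P)) => yP.
    have yW' : y \in W by rewrite inE yW.
    exact: IHp yW' yp zl.
  rewrite inE; apply/orP; right; apply/bigcupP; exists x => //.
  apply/bigcupP; exists y; first by rewrite yP andbT.
  by rewrite inE; apply/connectP; exists p.
have uR : u \in reach A u by exact: reachxx.
have uS : s0 <= #|reach A u| by apply: gap1; rewrite inE in uP.
apply: leq_trans uS (leq_trans (subset_leq_card sub) _).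
rewrite (leq_trans (leq_card_setU _ _)) // mulnDl mul1n leq_add2l.
rewrite (leq_trans (leq_card_bigcup _ _)) // mulnC -sum_nat_const.
apply: leq_sum => x _; rewrite (leq_trans (leq_card_bigcup _ _)) //.
have le y : ((x, y) \in A) && (y \notin P) -> #|reach A y| <= L.
  by case/andP=> _; rewrite inE -leqNgt.
apply: leq_trans (leq_sum _ le) _; rewrite sum_nat_const leq_mul2r.
apply/orP; right; apply: leq_trans (outdeg x).
by apply/subset_leq_card/subsetP=> y; rewrite !inE => /andP[].
Qed.

(* Double counting of the pairs [(u, w)] in [P * P] such that [u] reaches [w]. *)
Lemma card_strong_center : L < #|B|.
Proof.
rewrite ltnNge; apply/negP=> leB.
have [u0 u0P] := exists_far_reaching.
have P_gt0 : 0 < #|P| by apply/card_gt0P; exists u0.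
have lo : #|P| * s0 <= (1 + L * L) * \sum_(u in P) #|reach A u :&: P|.
  rewrite -sum_nat_const big_distrr; apply: leq_sum => u uP.
  exact: reach_in_far_reaching.
have xchg : \sum_(u in P) #|reach A u :&: P| = \sum_(w in P) #|coreach A w :&: P|.
  transitivity (\sum_(u in P) \sum_(w in P) (connect (arc_rel A) u w : nat)).
    apply: eq_bigr => u _; rewrite -sum1_card [LHS]big_mkcond [RHS]big_mkcond.
    by apply: eq_bigr => w _; rewrite !inE; case: connect; case: leq.
  rewrite exchange_big; apply: eq_bigr => w _ /=.
  rewrite -sum1_card [LHS]big_mkcond [RHS]big_mkcond.
  by apply: eq_bigr => u _; rewrite !inE; case: connect; case: leq.
(* The [w] in [Q] number at most [#|B| <= L] and contribute at most [#|P|] each; every other [w]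
   contributes at most [L]. *)
have hi : \sum_(w in P) #|coreach A w :&: P| <= #|P| * L + #|P| * L.
  rewrite (bigID [in Q]) /= leq_add //.
    have le w : (w \in P) && (w \in Q) -> #|coreach A w :&: P| <= #|P|.
      by move=> _; apply/subset_leq_card/subsetIr.
    apply: leq_trans (leq_sum _ le) _.
    rewrite sum_nat_const mulnC leq_mul2l; apply/orP; right.
    apply: leq_trans leB; rewrite /B; apply/eq_leq/eq_card => w.
    by rewrite in_setI.
  have le w : (w \in P) && (w \notin Q) -> #|coreach A w :&: P| <= L.
    move=> /andP[_]; rewrite inE -leqNgt; apply: leq_trans.
    exact/subset_leq_card/subsetIl.
  apply: leq_trans (leq_sum _ le) _.
  rewrite sum_nat_const leq_mul2r; apply/orP; right.
  by apply/subset_leq_card/subsetP=> w /andP[].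
rewrite xchg in lo.
(* Cancelling [#|P| > 0] leaves [s0 <= (1 + L * L) * (2 * L)], against [s0_large]. *)
have := leq_trans lo (leq_mul (leqnn _) hi).
move: s0_large P_gt0; move: (#|P|) (1 + L * L) => p q; nia.
Qed.

Lemma mem_center_reach x y : x \in P -> y \in Q -> y \in reach A x.
Proof. by rewrite !inE => xP yQ; have := link (gap1 xP) yQ; rewrite inE. Qed.

Lemma reach_sub x y : connect (arc_rel A) x y -> reach A y \subset reach A x.
Proof.
by move=> cxy; apply/subsetP=> z; rewrite !inE => /(connect_trans cxy).
Qed.

Lemma coreach_sub x y : connect (arc_rel A) x y -> coreach A x \subset coreach A y.
Proof.
by move=> cxy; apply/subsetP=> z; rewrite !inE => czx; apply: connect_trans czx cxy.
Qed.

Lemma far_reaching_pred x y : connect (arc_rel A) x y -> y \in P -> x \in P.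
Proof.
by move=> /reach_sub/subset_leq_card le; rewrite !inE => yP; apply: leq_trans yP le.
Qed.

Lemma far_reached_succ x y : connect (arc_rel A) x y -> x \in Q -> y \in Q.
Proof.
by move=> /coreach_sub/subset_leq_card le; rewrite !inE => yP; apply: leq_trans yP le.
Qed.

Lemma center_digraph_axiom : digraph_axiom (B, A :&: setX B B).
Proof.
apply/forallP=> x; apply/forallP=> y; apply/implyP; rewrite inE in_setX /=.
by case/and3P=> /arcs_vertices[_ _ ->] -> ->.
Qed.

Let HB := Digraph center_digraph_axiom.

(** A path between two vertices of [B] never leaves [B]: its vertices inherit [P] from the end of
    the path and [Q] from its start. *)
Lemma center_strongly_connected : strongly_connected HB.
Proof.
apply/andP; split.
  by rewrite -card_gt0; apply: leq_ltn_trans card_strong_center.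
apply/forallP=> x; apply/implyP=> xB; apply/forallP=> y; apply/implyP=> yB.
rewrite /vertices /arcs /= in xB yB *.
have [/setIP[xP xQ] /setIP[yP yQ]] := (xB, yB).
have := mem_center_reach xP yQ; rewrite inE => /connectP[p].
elim: p x xP xQ xB => [|z p IHp] x xP xQ xB /= => [_ ->|]; first exact: connect0.
case/andP=> xz zp yl.
have cxz : connect (arc_rel A) x z by apply: connect1.
have czy : connect (arc_rel A) z y by apply/connectP; exists p.
have zP := far_reaching_pred czy yP; have zQ := far_reached_succ cxz xQ.
have zB : z \in B by apply/setIP.
apply: connect_trans (IHp z zP zQ zB zp yl); apply: connect1.
by rewrite inE in_setX [_ \in _]xz xB zB.
Qed.

Lemma connect_subdigraph (H : digraph T) x y : subdigraph H G ->
  connect (fun x y => (x, y) \in arcs H) x y -> connect (arc_rel A) x y.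
Proof.
case/andP=> _ sA; apply: connect_sub => a b ab.
by apply: connect1; apply: (subsetP sA).
Qed.

(** [HB] lies in some strong component, so [H] has more than [L] vertices. Each of them then
    reaches, and is reached from, more than [L] vertices, so [H] is inside [HB], and maximality
    gives equality. *)
Lemma largest_is_center H : largest_strong_component G H -> H = HB.
Proof.
case/andP=> /and3P[HG scH maxH] largeH.
have HBG : subdigraph HB G.
  by apply/andP; split; [rewrite GT; apply: subsetT | apply: subsetIl].
have [K' cK' HBK'] := maximal_subdigraph_exists HBG center_strongly_connected.
have ltH : L < #|vertices H|.
  apply: leq_trans card_strong_center _.
  have /andP[/subset_leq_card le _] := HBK'; apply: (leq_trans le).
  by have /forallP/(_ K')/implyP/(_ cK') := largeH.
have conH x y : x \in vertices H -> y \in vertices H -> connect (arc_rel A) x y.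
  move=> xH yH; apply: (connect_subdigraph HG).
  by case/andP: scH => _ /forallP/(_ x)/implyP/(_ xH)/forallP/(_ y)/implyP/(_ yH).
have HBsub : vertices H \subset B.
  apply/subsetP=> x xH; rewrite !inE; apply/andP; split.
    apply: leq_trans ltH _; apply/subset_leq_card/subsetP=> y yH.
    by rewrite inE conH.
  apply: leq_trans ltH _; apply/subset_leq_card/subsetP=> y yH.
  by rewrite inE conH.
have HsubHB : subdigraph H HB.
  rewrite /subdigraph HBsub /=; apply/subsetP=> -[x y] xyH.
  rewrite inE in_setX /=; have /andP[_ /subsetP/(_ _ xyH) ->] := HG.
  have [xV yV _] := arcs_vertices xyH.
  by rewrite !(subsetP HBsub).
have /forallP/(_ HB) := maxH.
by rewrite HBG center_strongly_connected HsubHB => /eqP.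
Qed.

(** As [#|B| > L >= 1], every vertex of [B] has a partner in [B]; the paths from and to it supply
    the required arcs. *)
Lemma center_in_out_ge1 : in_out_ge1 HB.
Proof.
have ex x : x \in B -> exists2 y, y \in B & x != y.
  move=> xB; have := card_strong_center; rewrite (cardsD1 x) xB.
  rewrite ltnS => /(leq_trans L_gt0)/card_gt0P[y].
  by rewrite in_setD1 => /andP[yx yB]; exists y => //; rewrite eq_sym.
have con x y : x \in B -> y \in B -> connect (arc_rel (arcs HB)) x y.
  move=> xB yB; have /andP[_ /forallP/(_ x)/implyP/(_ xB)] := center_strongly_connected.
  by move/forallP/(_ y)/implyP/(_ yB).
apply/andP; split; apply/forallP=> x; apply/implyP=> xB; have [y yB xy] := ex x xB.
  have [|z _ zx] := connect_last (con y x yB xB); first by rewrite eq_sym.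
  by apply/card_gt0P; exists z; rewrite inE.
have := con x y xB yB; rewrite -connect_transpose => c.
have [|z _ zx] := connect_last c; first by rewrite eq_sym.
by apply/card_gt0P; exists z; rewrite !inE in zx *.
Qed.

Lemma center_sub_core K : is_core11 G K -> subdigraph HB K.
Proof.
move=> cK; have HBG : subdigraph HB G.
  by apply/andP; split; [rewrite GT; apply: subsetT | apply: subsetIl].
have [K' cK' sub] := maximal_subdigraph_exists HBG center_in_out_ge1.
by rewrite (core11_unique cK cK').
Qed.

(** A core vertex outside [P] starts an excess structure because the core has no sink; one in [P]
    but outside [Q] does so in the transpose because the core has no source. *)
Lemma card_core_diff K : is_core11 G K -> #|vertices K :\: B| <= 2 * M.
Proof.
case/and3P=> /andP[_ /subsetP sA] /andP[inK outK] _.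
rewrite mul2n -addnn.
apply: leq_trans (leq_add few_excess few_excess_tr).
apply: leq_trans (leq_card_setU _ _); apply/subset_leq_card/subsetP=> v.
rewrite inE => /andP[vB vK]; rewrite inE; case: (boolP (v \in P)) => [vP|vP].
  apply/orP; right; rewrite inE; apply: (@endless_has_excess _ _ _ (vertices K)) => //.
    move=> x xK; have /forallP/(_ x)/implyP/(_ xK)/card_gt0P[y] := inK.
    rewrite inE => yx; exists y; last by rewrite inE /= sA.
    by have [] := arcs_vertices yx.
  by rewrite -coreach_transpose leqNgt; apply: contra vB; rewrite !inE in vP *; rewrite vP.
apply/orP; left; rewrite inE; apply: (@endless_has_excess _ _ _ (vertices K)) => //.
  move=> x xK; have /forallP/(_ x)/implyP/(_ xK)/card_gt0P[y] := outK.
  rewrite inE => xy; exists y; last by rewrite sA.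
  by have [] := arcs_vertices xy.
by rewrite inE -leqNgt in vP.
Qed.

(** A core arc outside [HB] has an endpoint outside [B], and each vertex meets at most [2 * L]
    arcs. *)
Lemma card_core_arcs_diff K : is_core11 G K ->
  #|arcs K :\: arcs HB| <= 2 * M * (2 * L).
Proof.
move=> cK; apply: leq_trans (leq_mul (card_core_diff cK) (leqnn _)).
have /and3P[/andP[_ /subsetP sA] _ _] := cK.
have sub : arcs K :\: arcs HB \subset \bigcup_(v in vertices K :\: B)
    ([set (v, w) | w in [set w | (v, w) \in A]] :|:
     [set (u, v) | u in [set u | (u, v) \in A]]).
  apply/subsetP=> -[x y]; rewrite inE => /andP[xyB xyK].
  have xyA := sA _ xyK.
  have [xV yV _] := arcs_vertices xyK.
  move: xyB; rewrite inE in_setX [_ \in A]xyA /= negb_and => /orP[xB|yB].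
    apply/bigcupP; exists x; first by rewrite inE xB.
    by rewrite inE; apply/orP; left; apply/imsetP; exists y; rewrite ?inE.
  apply/bigcupP; exists y; first by rewrite inE yB.
  by rewrite inE; apply/orP; right; apply/imsetP; exists x; rewrite ?inE.
apply: leq_trans (subset_leq_card sub) (leq_trans (leq_card_bigcup _ _) _).
rewrite -sum_nat_const; apply: leq_sum => v _.
rewrite (leq_trans (leq_card_setU _ _)) // mul2n -addnn leq_add //.
  exact: leq_trans (leq_imset_card _ _) (outdeg v).
exact: leq_trans (leq_imset_card _ _) (indeg v).
Qed.

Lemma core_close_to_largest K H : is_core11 G K -> largest_strong_component G H ->
  [/\ #|vertices H| <= #|vertices K|, #|vertices K| <= #|vertices H| + 2 * M,
      #|arcs H| <= #|arcs K| & #|arcs K| <= #|arcs H| + 4 * M * L].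
Proof.
move=> cK /largest_is_center ->; have /andP[sV sA] := center_sub_core cK.
split; try exact: subset_leq_card.
  rewrite -(cardsID B (vertices K)) leq_add ?card_core_diff //.
  exact/subset_leq_card/subsetIr.
rewrite -(cardsID (arcs HB) (arcs K)) leq_add //.
  exact/subset_leq_card/subsetIr.
by apply: leq_trans (card_core_arcs_diff cK) _; rewrite mulnACA (_ : 2 * 2 = 4) ?mulnA.
Qed.

End Giant.

(** * Counting digraphs with a fixed number of arcs *)

Section Subsets.
Variables (E : finType) (D : {set E}).

Definition msets m : {set {set E}} := [set A : {set E} | A \subset D & #|A| == m].

Lemma card_msets m : #|msets m| = 'C(#|D|, m).
Proof. exact: cards_draws. Qed.

(** [A :\: J] is an arbitrary set of the remaining size outside [J :|: K]. If [J] is not inside [D],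
    the family is empty. *)
Lemma card_msets_constrained m (J K : {set E}) :
    K \subset D -> [disjoint J & K] ->
  #|[set A in msets m | J \subset A & [disjoint A & K]]| <=
    'C(#|D| - #|J| - #|K|, m - #|J|).
Proof.
move=> KD JK; case: (boolP (J \subset D)) => [JD|/negP JD]; last first.
  rewrite (_ : [set A in _ | _] = set0) ?cards0 //; apply/setP=> A.
  rewrite !inE; apply/negP=> /and3P[/andP[AD _] JA _].
  exact/JD/(subset_trans JA).
rewrite -subnDA -(_ : #|D :\: (J :|: K)| = #|D| - (#|J| + #|K|)); last first.
  rewrite cardsD (setIidPr _) ?subUset ?JD //; congr (_ - _).
  by rewrite cardsU; move/disjoint_setI0: JK => ->; rewrite cards0 subn0.
rewrite -cards_draws; set X := [set A in msets m | _].
have injX : {in X &, injective (fun A => A :\: J)}.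
  move=> A B /setIdP[_ /andP[JA _]] /setIdP[_ /andP[JB _]] eAB.
  by rewrite -(setID A J) -(setID B J) eAB (setIidPr JA) (setIidPr JB).
rewrite -(card_in_imset injX).
apply/subset_leq_card/subsetP=> B /imsetP[A /setIdP[Am0 /andP[JA AK]] ->].
move: Am0; rewrite !inE => /andP[AD /eqP Am]; apply/andP; split.
  apply/subsetP=> x; rewrite !inE => /andP[xJ xA].
  rewrite negb_or xJ (subsetP AD) // andbT.
  by apply/negP=> xK; move/disjointFr/(_ xA): AK; rewrite xK.
by rewrite cardsD (setIidPr JA) Am.
Qed.

End Subsets.

(** The quotient of the two binomials is a product of factors [(m - i) / (N - i)], each at most
    [m / N]. *)
Lemma bin_present_le N m j : j <= m -> m <= N ->
  'C(N - j, m - j) * N ^ j <= m ^ j * 'C(N, m).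
Proof.
move=> + mN; elim: j => [|j IHj] jm; first by rewrite !subn0 !expn0 muln1 mul1n.
have le := IHj (ltnW jm); have Nj : 0 < N - j by rewrite subn_gt0 (leq_trans jm).
have eq : (N - j) * 'C(N - j.+1, m - j.+1) = (m - j) * 'C(N - j, m - j).
  have := mul_bin_diag (N - j) (m - j.+1).
  by rewrite -subnS (subnSK jm).
have le' : (m - j) * N <= m * (N - j).
  by rewrite mulnBl mulnBr leq_sub2l // [leqLHS]mulnC leq_mul2l mN orbT.
rewrite -(leq_pmul2l Nj) !expnS mulnA eq.
have -> : (m - j) * 'C(N - j, m - j) * (N * N ^ j) =
  ((m - j) * N) * ('C(N - j, m - j) * N ^ j) by ring.
have -> : (N - j) * (m * m ^ j * 'C(N, m)) = (m * (N - j)) * (m ^ j * 'C(N, m)) by ring.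
exact: leq_mul.
Qed.

(** Here the factors are [(M - r - i) / (M - i)], each at most [(M - r) / M]. *)
Lemma bin_absent_le M r k : 'C(M - k, r) * M ^ k <= (M - r) ^ k * 'C(M, r).
Proof.
elim: k => [|k IHk]; first by rewrite subn0 !expn0 muln1 mul1n.
case: (leqP M k) => Mk.
  (* Subtraction is truncated here, and only [r = 0] leaves a nonzero binomial. *)
  have -> : M - k.+1 = 0 by apply/eqP; rewrite subn_eq0 (leq_trans Mk).
  case: r {IHk} => [|r]; last by rewrite bin0n.
  by rewrite !subn0 !bin0 muln1 mul1n.
have eq : (M - k) * 'C(M - k.+1, r) = (M - k - r) * 'C(M - k, r).
  by rewrite -mul_bin_down -subnS.
have Mk0 : 0 < M - k by rewrite subn_gt0.
have le' : (M - k - r) * M <= (M - r) * (M - k).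
  by rewrite -subnDA addnC subnDA mulnBl mulnBr leq_sub2l // [leqLHS]mulnC leq_mul2l leq_subr orbT.
rewrite -(leq_pmul2l Mk0) !expnS mulnA eq.
have -> : (M - k - r) * 'C(M - k, r) * (M * M ^ k) =
  ((M - k - r) * M) * ('C(M - k, r) * M ^ k) by ring.
have -> : (M - k) * ((M - r) * (M - r) ^ k * 'C(M, r)) =
  ((M - r) * (M - k)) * ((M - r) ^ k * 'C(M, r)) by ring.
exact: leq_mul.
Qed.

(** First fix the [j] present arcs; the [k] absent ones are then avoided by the [m - j] arcs left
    among [N - j]. *)
Lemma bin_constrained_le N m j k : j <= m -> m <= N ->
  'C(N - j - k, m - j) * (N ^ j * (N - j) ^ k) <= m ^ j * (N - m) ^ k * 'C(N, m).
Proof.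
move=> jm mN; have le1 := bin_present_le jm mN.
have := bin_absent_le (N - j) (m - j) k.
have -> : N - j - (m - j) = N - m by rewrite -subnDA subnKC.
move=> le2; rewrite (mulnC (N ^ j)) mulnA.
apply: leq_trans (leq_mul le2 (leqnn _)) _.
by rewrite -mulnA [leqRHS]mulnAC mulnC leq_mul2r le1 orbT.
Qed.

(** * First-moment counts for large degrees and excess structures *)

Section ArcCounting.
Variable T : finType.
Let n := #|T|.

Definition offdiag : {set T * T} := [set e | e.1 != e.2].

Lemma card_offdiag : #|offdiag| = n * n.-1.
Proof.
have -> : offdiag = ~: [set e : T * T | e.1 == e.2] by apply/setP=> e; rewrite !inE.
rewrite cardsCs setCK card_prod -subn1 mulnBr muln1; congr (_ - _).
rewrite -[RHS](card_imset (f := fun x : T => (x, x)) predT) => [|x y [] //].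
apply: eq_card => -[x y]; rewrite !inE; apply/eqP/imsetP => /= [->|[z _ [-> ->]] //].
by exists y.
Qed.

Lemma transpose_msets m A : (transpose A \in msets offdiag m) = (A \in msets offdiag m).
Proof.
rewrite !inE; congr andb.
  by apply/subsetP/subsetP=> h [x y] xy; have := h (y, x); rewrite !inE /= eq_sym in xy *; apply.
rewrite (_ : #|transpose A| = #|A|) //.
rewrite -(card_imset (f := fun e : T * T => (e.2, e.1)) (mem A)) => [|[a b] [c d] [-> ->] //].
apply: eq_card => -[x y]; rewrite !inE /=; apply/idP/imsetP => [h|[[a b] h [-> ->]] //].
by exists (y, x).
Qed.

(** Reversing all arcs preserves the uniform model, so each bound for out-arcs serves for in-arcs
    too. *)
Lemma card_msets_transpose m (P : pred {set T * T}) :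
  #|[set A in msets offdiag m | P (transpose A)]| = #|[set A in msets offdiag m | P A]|.
Proof.
rewrite -(card_imset _ (can_inj (@transposeK T))); apply: eq_card => A.
apply/imsetP/setIdP=> [[B /setIdP[Bm PB] ->]|[Am PA]].
  by rewrite transpose_msets.
exists (transpose A); last by rewrite transposeK.
by apply/setIdP; rewrite transpose_msets transposeK.
Qed.

Definition large_outdegree k (A : {set T * T}) : bool :=
  [exists v, k <= #|[set w | (v, w) \in A]|].

Definition many_excess L M (A : {set T * T}) : bool :=
  M <= #|[set v | has_excess A L v]|.

(** Union bound over the vertex and a set of [k] of its out-neighbours. *)
Lemma card_large_outdegree m k :
  #|[set A in msets offdiag m | large_outdegree k A]| <=
    n * 'C(n, k) * 'C(#|offdiag| - k, m - k).
Proof.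
have sub : [set A in msets offdiag m | large_outdegree k A] \subset
   \bigcup_(v : T) \bigcup_(W in [set W : {set T} | #|W| == k])
     [set A in msets offdiag m | setX [set v] W \subset A & [disjoint A & set0]].
  apply/subsetP=> A; rewrite inE => /andP[Am /existsP[v kv]].
  apply/bigcupP; exists v => //.
  have [W Wk sW] : exists2 W : {set T}, #|W| == k & W \subset [set w | (v, w) \in A].
    have : 0 < #|[set W : {set T} | W \subset [set w | (v, w) \in A] & #|W| == k]|.
      by rewrite cards_draws bin_gt0.
    by case/card_gt0P=> W; rewrite inE => /andP[]; exists W.
  apply/bigcupP; exists W; rewrite inE // Am disjoints_subset setC0 subsetT andbT /=.
  by apply/subsetP=> -[x y]; rewrite in_setX inE => /andP[/eqP-> /(subsetP sW)]; rewrite inE.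
apply: leq_trans (subset_leq_card sub) (leq_trans (leq_card_bigcup _ _) _).
have le v : true -> #|\bigcup_(W in [set W : {set T} | #|W| == k])
     [set A in msets offdiag m | setX [set v] W \subset A & [disjoint A & set0]]| <=
     'C(n, k) * 'C(#|offdiag| - k, m - k).
  move=> _; rewrite -card_draws; apply: leq_trans (leq_card_bigcup _ _) _.
  rewrite -sum_nat_const; apply: leq_sum => W; rewrite inE => /eqP Wk.
  have := @card_msets_constrained _ offdiag m (setX [set v] W) set0 (sub0set _).
  by rewrite cards0 subn0 cardsX cards1 Wk mul1n; apply; rewrite disjoints_subset setC0 subsetT.
by apply: leq_trans (leq_sum _ le) _; rewrite sum_nat_const mulnA.
Qed.

(** A fixed witness forces [#|S|] arcs inside [S] to be present and all [#|S| * (n - #|S|)] arcs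
    leaving [S] to be absent. *)
Lemma sum_card_excess_witness m L v S f e :
  #|[set A in msets offdiag m | excess_witness A L v S f e]| <=
    [&& v \in S, #|S| <= L, f \in pffun_on v (mem (S :\ v)) (mem S) & e \in setX S S]
    * 'C(#|offdiag| - #|S| - #|S| * (n - #|S|), m - #|S|).
Proof.
case: (boolP [&& _, _, _ & _]) => [/and4P[vS SL fS eS]|nw]; last first.
  rewrite mul0n leqn0 cards_eq0; apply/eqP/setP=> A; rewrite !inE.
  apply/negP=> /and3P[_ vS /and3P[SL fS /and3P[eS _ _]]].
  by move: nw; rewrite vS SL fS eS.
rewrite mul1n; case: (boolP (e \in tree_arcs v S f)) => eN.
  rewrite (_ : [set A in _ | _] = set0) ?cards0 //; apply/setP=> A.
  by rewrite !inE /excess_witness eN !andbF.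
have -> : #|S| = #|e |: tree_arcs v S f| by rewrite cardsU1 eN add1n card_tree_arcs.
have sJ : e |: tree_arcs v S f \subset setX S S.
  rewrite subUset sub1set eS; apply/subsetP=> _ /imsetP[w wS ->].
  rewrite in_setX; have /setD1P[_ ->] := wS.
  by have /pffun_onP[_ /(_ (f w))] := fS => ->//; apply/imageP; exists w.
have -> : #|e |: tree_arcs v S f| * (n - #|e |: tree_arcs v S f|) = #|setX S (~: S)|.
  by rewrite cardsX cardsU1 eN add1n card_tree_arcs // /n -(cardsC S) addKn.
apply: leq_trans (card_msets_constrained m (K := setX S (~: S)) _ _).
- apply/subset_leq_card/subsetP=> A; rewrite !inE.
  by case/and4P=> -> _ _ /and5P[_ _ _ -> ->].
- apply/subsetP=> -[x y]; rewrite in_setX !inE /= => /andP[xS yS].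
  by apply: contra yS => /eqP <-.
- rewrite disjoint_subset; apply: (subset_trans sJ); apply/subsetP=> -[x y].
  by rewrite !inE /= => /andP[-> ->].
Qed.

Lemma sum_over_small_sets L (F : nat -> nat) :
  \sum_(S : {set T} | #|S| <= L) F #|S| = \sum_(s < L.+1) 'C(n, s) * F s.
Proof.
rewrite (partition_big (fun S : {set T} => inord #|S| : 'I_L.+1) predT) //=.
apply: eq_bigr => s _; rewrite -card_draws -sum_nat_const.
apply: eq_big => [S|S]; rewrite ?inE.
  apply/andP/eqP=> [[SL /eqP <-]|eS]; first by rewrite inordK.
  rewrite -ltnS eS ltn_ord; split=> //; apply/eqP/val_inj.
  by rewrite /= inordK // -ltnS eS.
by case/andP=> SL /eqP <-; rewrite inordK.
Qed.

(** For [#|S| = s] there are [s] roots, [s ^ (s - 1)] parent maps and [s ^ 2] choices of the extra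
    arc, hence the factor [s ^ s.+2]. *)
Lemma sum_excess_le m L :
  \sum_(A in msets offdiag m) #|[set v | has_excess A L v]| <=
  \sum_(s < L.+1) 'C(n, s) * (s ^ s.+2 * 'C(#|offdiag| - s - s * (n - s), m - s)).
Proof.
pose g s := 'C(#|offdiag| - s - s * (n - s), m - s).
have -> : \sum_(A in msets offdiag m) #|[set v | has_excess A L v]| =
    \sum_v #|[set A in msets offdiag m | has_excess A L v]|.
  transitivity (\sum_(A in msets offdiag m) \sum_v (has_excess A L v : nat)).
    apply: eq_bigr => A _; rewrite -sum1_card [LHS]big_mkcond.
    by apply: eq_bigr => v _; rewrite inE; case: has_excess.
  rewrite exchange_big; apply: eq_bigr => v _ /=.
  rewrite -sum1_card [LHS]big_mkcond [RHS]big_mkcond.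
  by apply: eq_bigr => A _; rewrite !inE; case: has_excess; case: andb.
have le1 v : true -> #|[set A in msets offdiag m | has_excess A L v]| <=
    \sum_(S : {set T} | (v \in S) && (#|S| <= L)) #|S| ^ #|S|.+1 * g #|S|.
  move=> _; have sub : [set A in msets offdiag m | has_excess A L v] \subset
      \bigcup_(S : {set T}) \bigcup_(f : {ffun T -> T}) \bigcup_(e : T * T)
      [set A in msets offdiag m | excess_witness A L v S f e].
    apply/subsetP=> A; rewrite inE => /andP[Am /existsP[S /existsP[f /existsP[e w]]]].
    apply/bigcupP; exists S => //; apply/bigcupP; exists f => //.
    by apply/bigcupP; exists e => //; rewrite inE Am.
  apply: leq_trans (subset_leq_card sub) (leq_trans (leq_card_bigcup _ _) _).
  rewrite [leqRHS]big_mkcond; apply: leq_sum => S _.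
  case: (boolP (_ && _)) => [/andP[vS SL]|nS]; last first.
    rewrite leqn0 cards_eq0; apply/eqP/big1 => f _; apply: big1 => e _.
    apply/setP=> A; rewrite !inE; apply/negP=> /and3P[_ vS /andP[SL _]].
    by rewrite vS SL in nS.
  rewrite -(_ : #|pffun_on v (mem (S :\ v)) (mem S)| * #|setX S S| = #|S| ^ #|S|.+1); last first.
    have eS : #|S| = #|S :\ v|.+1 by rewrite (cardsD1 v S) vS add1n.
    have pow a b c : b = c.+1 -> a ^ c * (a * a) = a ^ b.+1.
      by move=> ->; rewrite !expnSr mulnA.
    by rewrite card_pffun_on cardsX (pow _ _ _ eS).
  rewrite -mulnA -[leqRHS]sum_nat_const [leqRHS]big_mkcond.
  apply: leq_trans (leq_card_bigcup _ _) _; apply: leq_sum => f _.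
  rewrite (fun_if (fun x => _ <= x)); case: ifP => fS; last first.
    rewrite leqn0 cards_eq0; apply/eqP/big1 => e _; apply/setP=> A; rewrite !inE.
    by apply/negP=> /and5P[_ _ _ fS' _]; rewrite fS' in fS.
  rewrite -sum_nat_const [leqRHS]big_mkcond.
  apply: leq_trans (leq_card_bigcup _ _) _; apply: leq_sum => e _.
  apply: leq_trans (sum_card_excess_witness m L v S f e) _.
  by rewrite vS SL [f \in _]fS /=; case: (e \in _); rewrite ?mul1n ?mul0n.
apply: leq_trans (leq_sum _ le1) _.
rewrite (exchange_big_dep [pred S : {set T} | #|S| <= L]) /=; last by move=> ? ? _ /andP[].
rewrite -(sum_over_small_sets L (fun s => s ^ s.+2 * g s)); apply: leq_sum => S SL.
rewrite sum_nat_const (_ : #|_| = #|S|) ?mulnA -?expnS //.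
by apply: eq_card => v; rewrite [LHS]inE SL andbT.
Qed.

(** Markov's inequality in counting form. *)
Lemma card_many_excess m L M :
  #|[set A in msets offdiag m | many_excess L M A]| * M <=
  \sum_(s < L.+1) 'C(n, s) * (s ^ s.+2 * 'C(#|offdiag| - s - s * (n - s), m - s)).
Proof.
apply: leq_trans (sum_excess_le m L).
rewrite -sum_nat_const [leqRHS](bigID (many_excess L M)) /=.
apply: leq_trans (leq_addr _ _); rewrite big_mkcond [leqRHS]big_mkcond.
apply: leq_sum => A _; rewrite inE; by case: (A \in _) => //=; case: ifP.
Qed.

End ArcCounting.

(** * The exceptional arc sets *)

Section BadArcs.
Variable T : finType.
Implicit Types (A : {set T * T}) (L M : nat).

Definition has_gap L (s0 : nat) A : bool := [exists u, L < #|reach A u| < s0].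

Definition has_initial_gap L (s0 : nat) A : bool :=
  [exists k : 'I_#|T|.+1, L < #|reach_from A (initial_set T k)| < s0].

Definition unlinked L (s0 : nat) A u v : bool :=
  [&& s0 <= #|reach A u|, L < #|coreach A v| & v \notin reach A u].

Definition has_unlinked L (s0 : nat) A : bool :=
  [exists u, exists v, unlinked L s0 A u v].

(** The disjuncts negate the probabilistic hypotheses of the deterministic section; an upper bound
    [L] or [M] fails exactly from [L.+1] or [M.+1] on. *)
Definition bad_arcs L s0 M A : bool :=
  [|| has_gap L s0 A, has_initial_gap L s0 A, has_unlinked L s0 A,
      large_outdegree L.+1 A, large_outdegree L.+1 (transpose A),
      many_excess L M.+1 A | many_excess L M.+1 (transpose A)].

Lemma good_core_close (G : digraph T) L s0 M K H :
    vertices G = [set: T] -> ~~ bad_arcs L s0 M (arcs G) ->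
    0 < L -> (1 + L * L) * (2 * L) < s0 -> s0 <= #|T| ->
    is_core11 G K -> largest_strong_component G H ->
  [/\ #|vertices H| <= #|vertices K|, #|vertices K| <= #|vertices H| + 2 * M,
      #|arcs H| <= #|arcs K| & #|arcs K| <= #|arcs H| + 4 * M * L].
Proof.
rewrite /bad_arcs !negb_or => GT /and5P[gap igap unl od /and3P[id me met]] L0 s0L s0T.
have gapk (k : 'I_#|T|.+1) : #|reach_from (arcs G) (initial_set T k)| < s0 ->
    #|reach_from (arcs G) (initial_set T k)| <= L.
  by move=> lt; move/existsPn/(_ k): igap; rewrite lt andbT -leqNgt.
apply: (@core_close_to_largest _ G L s0 M) => //.
- by move=> u ltu; move/existsPn/(_ u): gap; rewrite ltu -leqNgt.
(* Beyond [#|T|] the initial set is the whole vertex set, as it is for [k = #|T|]. *)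
- move=> k; case: (leqP k #|T|) => kT; first exact: (gapk (Ordinal (kT : k < #|T|.+1))).
  have := gapk ord_max; rewrite /initial_set /= !take_oversize // -?cardT //.
  exact: ltnW.
- move=> u v su Lv; move/existsPn/(_ u): unl => /existsPn/(_ v).
  by rewrite /unlinked su Lv /= negbK.
- by move=> v; move/existsPn/(_ v): od; rewrite -leqNgt.
- move=> v; move/existsPn/(_ v): id; rewrite -leqNgt; apply: leq_trans.
  by apply/subset_leq_card/subsetP=> u; rewrite !inE.
- by rewrite leqNgt.
- by rewrite leqNgt.
Qed.

End BadArcs.

(** * From digraphs to their arc sets *)

Section UniformDigraphs.
Variables n m : nat.

Lemma arcs_inj_digraphs_nm : {in digraphs_nm n m &, injective (@arcs _)}.
Proof.
move=> G H; rewrite !inE => /andP[/eqP GV _] /andP[/eqP HV _] eA.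
by apply: digraph_eq => //; rewrite GV HV.
Qed.

Lemma arcs_digraphs_nm : @arcs _ @: digraphs_nm n m = msets (offdiag 'I_n) m.
Proof.
apply/setP=> A; apply/imsetP/idP=> [[G]|].
  rewrite inE => /andP[_ Gm] ->; rewrite inE Gm andbT; apply/subsetP=> -[x y] xy.
  by rewrite inE; have [] := arcs_vertices xy.
rewrite inE => /andP[/subsetP AD Am].
have ax : digraph_axiom ([set: 'I_n], A).
  apply/forallP=> x; apply/forallP=> y; apply/implyP=> /AD.
  by rewrite !inE.
by exists (Digraph ax); rewrite // inE /vertices /arcs /= eqxx.
Qed.

Lemma card_digraphs_nm : #|digraphs_nm n m| = 'C(#|offdiag 'I_n|, m).
Proof.
by rewrite -card_msets -arcs_digraphs_nm (card_in_imset arcs_inj_digraphs_nm).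
Qed.

(** A digraph on the full vertex set is determined by its arcs, so the digraphs violating [E] inject
    into the bad arc sets. *)
Lemma card_good_digraphs (E : pred (digraph 'I_n)) (bad : pred {set 'I_n * 'I_n}) :
    (forall G, vertices G = [set: 'I_n] -> ~~ bad (arcs G) -> E G) ->
  'C(#|offdiag 'I_n|, m) <= #|[set G in digraphs_nm n m | E G]|
     + #|[set A in msets (offdiag 'I_n) m | bad A]|.
Proof.
move=> goodE; rewrite -card_digraphs_nm -(cardsID [set G | E G]) leq_add //.
  by apply/subset_leq_card/subsetP=> G; rewrite !inE.
have inj : {in digraphs_nm n m :\: [set G | E G] &, injective (@arcs _)}.
  by move=> G H /setDP[Gm _] /setDP[Hm _]; apply: arcs_inj_digraphs_nm.
rewrite -(card_in_imset inj); apply/subset_leq_card/subsetP=> A /imsetP[G /setDP[Gm GE] ->].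
have Am : arcs G \in msets (offdiag 'I_n) m by rewrite -arcs_digraphs_nm imset_f.
apply/setIdP; split=> //; apply: contraR GE => /goodE EG; rewrite inE; apply: EG.
by move: Gm; rewrite inE => /andP[/eqP].
Qed.

End UniformDigraphs.

(** * Independent arcs *)

Import Order.TTheory GRing.Theory Num.Theory.
Local Open Scope ring_scope.

Section ProductMeasure.
Variables (R : realFieldType) (E : finType) (pr : E -> R).
Hypothesis pr01 : forall e, 0 <= pr e <= 1.
Implicit Types (A B : {set E}) (P : pred {set E}).

Definition weight A : R := \prod_e (if e \in A then pr e else 1 - pr e).
Definition mu P : R := \sum_(A | P A) weight A.

Lemma weight_ge0 A : 0 <= weight A.
Proof.
apply: prodr_ge0 => e _; have /andP[p0 p1] := pr01 e.
by case: ifP; rewrite ?subr_ge0.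
Qed.

Lemma mu_total : mu predT = 1.
Proof.
rewrite /mu /weight -(bigA_distr _ _ pr (fun e => 1 - pr e)).
by apply: big1 => e _ /=; rewrite addrC subrK.
Qed.

Lemma mu_union (I : finType) (Q : pred I) (P : I -> pred {set E}) P0 :
    (forall A, P0 A -> exists2 i, Q i & P i A) ->
  mu P0 <= \sum_(i | Q i) mu (P i).
Proof.
move=> cov; rewrite /mu.
rewrite [leRHS](eq_bigr (fun i => \sum_A if P i A then weight A else 0)); last first.
  by move=> i _; rewrite big_mkcond.
rewrite exchange_big big_mkcond; apply: ler_sum => A _.
case: ifP => [/cov[i Qi PA]|_]; last first.
  by apply: sumr_ge0 => i _; case: ifP; rewrite ?weight_ge0.
rewrite (bigD1 i) //= [P i A]PA lerDl; apply: sumr_ge0 => j _.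
by case: ifP; rewrite ?weight_ge0.
Qed.

(** Pair each [A] without [e] with [e |: A]: both satisfy [P] or neither does, and their weights are
    in the ratio [1 - pr e] to [pr e]. *)
Lemma mu_avoid1 P e : (forall A, P (A :\ e) = P A) ->
  mu [pred A | P A && (e \notin A)] = (1 - pr e) * mu P.
Proof.
move=> invP; pose w' A : R := \prod_(f | f != e) (if f \in A then pr f else 1 - pr f).
have wN A : e \notin A -> weight A = (1 - pr e) * w' A.
  by move=> eA; rewrite /weight (bigD1 e) //= (negbTE eA).
have wU A : e \notin A -> weight (e |: A) = pr e * w' A.
  move=> eA; rewrite /weight (bigD1 e) //= setU11; congr (_ * _).
  by apply: eq_bigr => f fe; rewrite !inE (negbTE fe).
have e1 : mu [pred A | P A && (e \notin A)] =
    (1 - pr e) * \sum_(A | P A && (e \notin A)) w' A.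
  by rewrite big_distrr; apply: eq_bigr => A /andP[_]; apply: wN.
rewrite e1; congr (_ * _); rewrite /mu [RHS](bigID (fun A => e \in A)) /=.
rewrite [X in _ = X + _](reindex_onto (fun A => e |: A) (fun A => A :\ e)) /=; last first.
  by move=> A /andP[_ eA]; rewrite setD1K.
rewrite [X in _ = X + _](eq_bigl (fun A => P A && (e \notin A))); last first.
  move=> A; rewrite setU11 andbT; case: (boolP (e \in A)) => eA /=; last first.
    by rewrite -(invP (e |: A)) !setU1K // eqxx.
  rewrite [RHS]andbF; apply/negP=> /andP[_ /eqP eqA].
  by rewrite -eqA !inE eqxx in eA.
rewrite -big_split; apply: eq_bigr => A /andP[_ eA].
by rewrite /= wU // wN // -mulrDl addrC subrK mul1r.
Qed.

Lemma mu_avoid P (s : seq E) : uniq s ->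
    (forall e A, e \in s -> P (A :\ e) = P A) ->
  mu [pred A | P A && all [predC A] s] = \prod_(e <- s) (1 - pr e) * mu P.
Proof.
elim: s => [|e s IHs] /= => [_ _|/andP[es us] invP].
  by rewrite big_nil mul1r; apply: eq_bigl => A; rewrite /= andbT.
rewrite big_cons -mulrA -IHs => // [|f A fs]; last by rewrite invP // inE fs orbT.
rewrite -mu_avoid1 => [|A]; first by apply: eq_bigl => A /=; rewrite -andbA; congr andb; rewrite andbC.
rewrite /= invP ?mem_head //; congr andb; apply: eq_in_all => f fs /=.
by rewrite in_setD1; case: eqP fs => // ->; rewrite (negbTE es).
Qed.

Definition avoid_pr B : R := \prod_(e in B) (1 - pr e).

(* A pair [(B, b)] stands for the event that [A] avoids [B] if [b], and meets
   [B] otherwise. *)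
Lemma mu_blocks (l : seq ({set E} * bool)) :
    pairwise (fun x y : {set E} * bool => [disjoint x.1 & y.1]) l ->
  mu [pred A | all (fun x => (A :&: x.1 == set0) == x.2) l] =
    \prod_(x <- l) (if x.2 then avoid_pr x.1 else 1 - avoid_pr x.1).
Proof.
elim: l => [_|[B b] l IHl] /=; first by rewrite big_nil -mu_total; apply: eq_bigl.
case/andP=> dB dl; rewrite big_cons /= -IHl //; set P := [pred A | all _ l].
have avoidB : mu [pred A | P A && (A :&: B == set0)] = avoid_pr B * mu P.
  rewrite /avoid_pr -big_enum -mu_avoid ?enum_uniq //.
    apply: eq_bigl => A /=; congr andb; rewrite setIC setI_eq0 disjoint_subset.
    apply/subsetP/allP=> h e; last by move=> eB; apply: h; rewrite mem_enum.
    by rewrite mem_enum => /h.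
  move=> e A; rewrite mem_enum => eB; apply: eq_in_all => x xl /=.
  have /allP/(_ x xl) dBx := dB; congr (_ == _); congr (_ == _).
  apply/setP=> f; rewrite !inE; case: eqP => //= ->.
  by rewrite (disjointFr dBx eB) andbF.
case: b => /=.
  by rewrite -avoidB; apply: eq_bigl => A /=; rewrite eqb_id andbC.
rewrite mulrBl mul1r -avoidB; apply/eqP; rewrite eq_sym subr_eq; apply/eqP.
rewrite [LHS](bigID (fun A => A :&: B == set0)) addrC /=; congr (_ + _).
by apply: eq_bigl => A /=; rewrite eqbF_neg andbC.
Qed.

End ProductMeasure.

(** * Binomial point probabilities *)

Section BinomialWeights.
Variable R : realFieldType.

Definition binomial_weight (n k : nat) (q : R) : R :=
  'C(n, k)%:R * q ^+ k * (1 - q) ^+ (n - k).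

Lemma binomial_weight_ge0 n k q : 0 <= q <= 1 -> 0 <= binomial_weight n k q.
Proof.
by case/andP=> q0 q1; rewrite !mulr_ge0 ?exprn_ge0 ?subr_ge0.
Qed.

(** The left side is one term of the expansion of the generating function on the right; this is
    Chernoff's bound before optimising [lam]. *)
Lemma binomial_weight_tilted n k q lam : 0 <= q <= 1 -> 0 < lam -> (k <= n)%N ->
  binomial_weight n k q * lam ^+ k <= (1 - q + lam * q) ^+ n.
Proof.
case/andP=> q0 q1 lam0 kn.
have kn1 : (k < n.+1)%N by [].
rewrite exprDn (bigD1 (Ordinal kn1)) //=.
rewrite -[leLHS]addr0 lerD //.
  by rewrite /binomial_weight exprMn -mulr_natl; rewrite le_eqVlt; apply/orP; left; apply/eqP; ring.
apply: sumr_ge0 => i _; rewrite mulrn_wge0 // mulr_ge0 ?exprn_ge0 ?subr_ge0 //.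
by rewrite mulr_ge0 // ltW.
Qed.

Lemma binomial_weight_le1 n k q : 0 <= q <= 1 -> (k <= n)%N ->
  binomial_weight n k q <= 1.
Proof.
move=> q01 kn; have := binomial_weight_tilted q01 ltr01 kn.
by rewrite expr1n mulr1 mul1r subrK expr1n.
Qed.

End BinomialWeights.

(** * Exploration of a random digraph with independent arcs *)

Section ArcMeasure.
Variables (R : realFieldType) (T : finType) (p : R).
Hypothesis p01 : 0 <= p <= 1.
Let n := #|T|.

(** Loops get probability 0, so the product measure can live on all ordered pairs. *)
Definition arc_pr (e : T * T) : R := if e \in offdiag T then p else 0.

Lemma arc_pr01 e : 0 <= arc_pr e <= 1.
Proof. by rewrite /arc_pr; case: ifP => _ //; rewrite lexx ler01. Qed.

(* The probability that at least one of [s] given possible arcs is present. *)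
Definition hit (s : nat) : R := 1 - (1 - p) ^+ s.

Lemma hit01 s : 0 <= hit s <= 1.
Proof.
have /andP[p0 p1] := p01.
rewrite /hit subr_ge0 exprn_ile1 ?subr_ge0 ?lerBlDr ?lerDl //=.
by rewrite exprn_ge0 ?subr_ge0.
Qed.

Lemma avoid_arc_pr (B : {set T * T}) :
  avoid_pr arc_pr B = (1 - p) ^+ #|B :&: offdiag T|.
Proof.
rewrite /avoid_pr -prodr_const big_mkcond [RHS]big_mkcond.
apply: eq_bigr => e _; rewrite /arc_pr in_setI; case: (e \in B) => //=.
by case: ifP => //; rewrite subr0.
Qed.

Lemma avoid_arc_pr_ge (B : {set T * T}) : (1 - p) ^+ #|B| <= avoid_pr arc_pr B.
Proof.
have /andP[p0 p1] := p01; rewrite avoid_arc_pr.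
by apply: ler_wiXn2l; rewrite ?subr_ge0 ?lerBlDr ?lerDl // subset_leq_card ?subsetIl.
Qed.

Lemma factors_ge0 (l : seq ({set T * T} * bool)) :
  0 <= \prod_(x <- l) (if x.2 then avoid_pr arc_pr x.1 else 1 - avoid_pr arc_pr x.1).
Proof.
have /andP[p0 p1] := p01; apply: prodr_ge0 => x _; rewrite avoid_arc_pr.
by case: ifP => _; rewrite ?subr_ge0 ?exprn_ge0 ?exprn_ile1 ?subr_ge0 ?lerBlDr ?lerDl.
Qed.

(** For [w] in [S] the block may contain a loop, so it is met with probability at most [hit s]; for
    [w] outside [S] it is loop-free and the factor is exact. *)
Lemma block_factors_le (U S : {set T}) (B : T -> {set T * T}) s :
    (forall w, #|B w| = s) ->
    {in U, forall w, w \notin S -> B w \subset offdiag T} ->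
  \prod_(x <- [seq (B w, w \notin S) | w <- enum U])
     (if x.2 then avoid_pr arc_pr x.1 else 1 - avoid_pr arc_pr x.1)
  <= hit s ^+ #|U :&: S| * (1 - hit s) ^+ #|U :\: S|.
Proof.
move=> cB offB; have /andP[p0 p1] := p01; have /andP[h0 h1] := hit01 s.
rewrite big_map big_enum /= (bigID [in S]) /=.
rewrite -!prodr_const; apply: ler_pM; try by
  apply: prodr_ge0 => w _; case: ifP; rewrite avoid_arc_pr ?subr_ge0 ?exprn_ge0 ?exprn_ile1 ?subr_ge0 ?lerBlDr ?lerDl.
  rewrite [leRHS](eq_bigl (fun w => (w \in U) && (w \in S))) => [|w]; last by rewrite inE.
  apply: ler_prod => w /andP[_ wS]; rewrite wS /= /hit lerD2l lerN2 -(cB w).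
  rewrite avoid_arc_pr_ge andbT avoid_arc_pr subr_ge0.
  by rewrite exprn_ile1 ?subr_ge0 ?lerBlDr ?lerDl.
rewrite [leRHS](eq_bigl (fun w => (w \in U) && (w \notin S))) => [|w]; last by rewrite inE andbC.
apply: ler_prod => w /andP[wU wS]; rewrite wS avoid_arc_pr exprn_ge0 ?subr_ge0 //=.
by rewrite (setIidPl (offB w wU wS)) cB /hit subKr.
Qed.

Definition reach_blocks (X S : {set T}) : seq ({set T * T} * bool) :=
  [seq (setX S [set w], w \notin S) | w <- enum (~: X)].

(** Only tails [x] outside [S] are tested, which keeps these blocks disjoint from
    [reach_blocks X S], whose arcs all start in [S]. *)
Definition coreach_blocks (v : T) (S U : {set T}) : seq ({set T * T} * bool) :=
  [seq (setX [set x] U, x \notin U) | x <- enum (~: (v |: S))].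

Definition block_test (A : {set T * T}) (x : {set T * T} * bool) : bool :=
  (A :&: x.1 == set0) == x.2.

Lemma reach_from_blocks A X S : reach_from A X = S ->
  all (block_test A) (reach_blocks X S).
Proof.
move=> <-; rewrite all_map; apply/allP=> w; rewrite mem_enum inE => wX.
by rewrite /= /block_test /= reach_from_block.
Qed.

Lemma coreach_from_blocks A v S U : coreach A v = U ->
  all (block_test A) (coreach_blocks v S U).
Proof.
move=> <-; rewrite all_map; apply/allP=> x; rewrite mem_enum in_setC in_setU1 negb_or => /andP[xv _].
by rewrite /= /block_test /= coreach_block.
Qed.

Lemma pairwise_uniq_map (I : eqType) (J : Type) (f : I -> J) (r : rel J) (s : seq I) :
  uniq s -> {in s &, forall x y, x != y -> r (f x) (f y)} -> pairwise r (map f s).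
Proof.
elim: s => //= x s IHs /andP[xs us] rf; rewrite IHs // ?andbT; last first.
  by move=> y z ys zs; apply: rf; rewrite inE ?ys ?zs orbT.
rewrite all_map; apply/allP=> y ys; apply: rf; rewrite ?mem_head ?inE ?ys ?orbT //.
by apply: contra xs => /eqP->.
Qed.

Lemma disjoint_reach_blocks X S :
  pairwise (fun x y : {set T * T} * bool => [disjoint x.1 & y.1]) (reach_blocks X S).
Proof.
apply: pairwise_uniq_map; first exact: enum_uniq.
move=> w w' _ _ ww' /=; rewrite disjoint_subset; apply/subsetP=> -[a b].
by rewrite !inE /= => /andP[_ /eqP->]; rewrite (negbTE ww') andbF.
Qed.

Lemma disjoint_coreach_blocks v S U :
  pairwise (fun x y : {set T * T} * bool => [disjoint x.1 & y.1]) (coreach_blocks v S U).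
Proof.
apply: pairwise_uniq_map; first exact: enum_uniq.
move=> w w' _ _ ww' /=; rewrite disjoint_subset; apply/subsetP=> -[a b].
by rewrite !inE /= => /andP[/eqP-> _]; rewrite (negbTE ww').
Qed.

Lemma offdiag_reach_block (S : {set T}) w : w \notin S -> setX S [set w] \subset offdiag T.
Proof.
move=> wS; apply/subsetP=> -[a b]; rewrite !inE /= => /andP[aS /eqP->].
by apply: contra wS => /eqP<-.
Qed.

Lemma offdiag_coreach_block (U : {set T}) x : x \notin U -> setX [set x] U \subset offdiag T.
Proof.
move=> xU; apply/subsetP=> -[a b]; rewrite !inE /= => /andP[/eqP-> bU].
by apply: contra xU => /eqP->.
Qed.

Lemma reach_factors_le (X S : {set T}) : X \subset S ->
  \prod_(x <- reach_blocks X S)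
     (if x.2 then avoid_pr arc_pr x.1 else 1 - avoid_pr arc_pr x.1)
  <= hit #|S| ^+ (#|S| - #|X|) * (1 - hit #|S|) ^+ (n - #|S|).
Proof.
move=> XS; apply: le_trans (block_factors_le (s := #|S|) _ _) _.
- by move=> w; rewrite cardsX cards1 muln1.
- by move=> w _; apply: offdiag_reach_block.
rewrite (_ : #|~: X :&: S| = #|S| - #|X|)%N; last first.
  by rewrite setIC -setDE cardsD (setIidPr XS).
rewrite (_ : #|~: X :\: S| = n - #|S|)%N //.
rewrite setDE (setIidPr _) ?setCS //; by rewrite /n -(cardsC S) addKn.
Qed.

Lemma coreach_factors_le v (S U : {set T}) : v \in U -> [disjoint U & S] ->
  \prod_(x <- coreach_blocks v S U)
     (if x.2 then avoid_pr arc_pr x.1 else 1 - avoid_pr arc_pr x.1)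
  <= hit #|U| ^+ (#|U| - 1) * (1 - hit #|U|) ^+ (n - #|S| - #|U|).
Proof.
move=> vU US; apply: le_trans (block_factors_le (s := #|U|) _ _) _.
- by move=> w; rewrite cardsX cards1 mul1n.
- by move=> w _; apply: offdiag_coreach_block.
rewrite (_ : #|~: (v |: S) :&: U| = #|U| - 1)%N; last first.
  rewrite setIC -setDE [in RHS](cardsD1 v U) vU add1n subn1 /=; apply: eq_card => x.
  rewrite !inE negb_or -andbA; case: (boolP (x \in U)) => [xU|]; rewrite ?andbF ?andbT //.
  by rewrite (disjointFr US xU) andbT.
rewrite (_ : #|~: (v |: S) :\: U| = n - #|S| - #|U|)%N //.
have -> : ~: (v |: S) :\: U = ~: (S :|: U).
  apply/setP=> x; rewrite !inE !negb_or andbC -andbA; case: eqP => // -> /=.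
  by rewrite vU andbF.
rewrite -subnDA -(_ : #|S :|: U| = #|S| + #|U|)%N; last first.
  by rewrite cardsU setIC (disjoint_setI0 US) cards0 subn0.
by rewrite /n -(cardsC (S :|: U)) addKn.
Qed.

Lemma card_sets_through (D X : {set T}) s :
  (#|[set S : {set T} | [&& X \subset S, S \subset D & #|S| == s]]| <=
    'C(#|D| - #|X|, s - #|X|))%N.
Proof.
have X0 : [disjoint X & set0] by rewrite disjoints_subset setC0 subsetT.
have := card_msets_constrained s (sub0set D) X0; rewrite cards0 subn0.
apply: leq_trans; apply/subset_leq_card/subsetP=> S; rewrite !inE.
by case/and3P=> -> -> ->; rewrite disjoints_subset setC0 subsetT.
Qed.

Notation mu := (mu arc_pr).

(** Union bound over the possible reachable sets [S]: their number supplies the binomial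
    coefficient, and the blocks of each supply the powers. *)
Lemma mu_reach_card (X : {set T}) s : (#|X| <= s)%N ->
  mu [pred A | #|reach_from A X| == s] <= binomial_weight (n - #|X|) (s - #|X|) (hit s).
Proof.
move=> Xs; have /andP[h0 h1] := hit01 s.
pose F := [set S : {set T} | [&& X \subset S, S \subset setT & #|S| == s]].
have cov A : #|reach_from A X| == s ->
    exists2 S, S \in F & all (block_test A) (reach_blocks X S).
  move=> As; exists (reach_from A X); last exact: reach_from_blocks.
  by rewrite inE sub_reach_from subsetT.
apply: le_trans (mu_union arc_pr01 cov) _.
have le S : S \in F -> mu (fun A => all (block_test A) (reach_blocks X S)) <=
    hit s ^+ (s - #|X|) * (1 - hit s) ^+ (n - s).
  rewrite inE => /and3P[XS _ /eqP <-]; apply: le_trans (reach_factors_le XS).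
  by rewrite -(mu_blocks arc_pr (disjoint_reach_blocks X S)).
apply: le_trans (ler_sum _ le) _; rewrite sumr_const -[leLHS]mulr_natl.
rewrite /binomial_weight -mulrA subnBA // subnK ?max_card //.
rewrite ler_wpM2r ?ler_nat //; last by have := card_sets_through setT X s; rewrite cardsT.
by rewrite mulr_ge0 ?exprn_ge0 // subr_ge0.
Qed.

(** If [v] is not reached from [u], then [coreach A v] misses [S = reach A u]. The forward blocks
    start in [S] and the backward ones outside it, so they are independent. *)
Lemma mu_unlinked u v s t : (0 < s)%N -> (0 < t)%N ->
  mu [pred A | [&& #|reach A u| == s, #|coreach A v| == t & v \notin reach A u]] <=
    binomial_weight (n - 1) (s - 1) (hit s) * binomial_weight (n - s - 1) (t - 1) (hit t).
Proof.
move=> s0 t0; have /andP[h0 h1] := hit01 s; have /andP[k0 k1] := hit01 t.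
pose F := [pred S : {set T} | [&& u \in S, #|S| == s & v \notin S]].
pose G S := [set U : {set T} | [&& [set v] \subset U, U \subset ~: S & #|U| == t]].
have cov A : [&& #|reach A u| == s, #|coreach A v| == t & v \notin reach A u] ->
    exists2 SU : {set T} * {set T}, (SU.1 \in F) && (SU.2 \in G SU.1) &
      all (block_test A) (reach_blocks [set u] SU.1 ++ coreach_blocks v SU.1 SU.2).
  case/and3P=> As At vN; exists (reach A u, coreach A v).
    apply/andP; split; first by rewrite inE /= reachxx As vN.
    rewrite inE /= sub1set coreachxx At andbT.
    apply/subsetP=> x; rewrite !inE in vN * => cxv; apply: contra vN => cux.
    exact: connect_trans cux cxv.
  by rewrite all_cat reach_from_blocks ?reach_from1 //= coreach_from_blocks.
apply: le_trans (mu_union arc_pr01 cov) _.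
pose c := hit s ^+ (s - 1) * (1 - hit s) ^+ (n - s) *
  (hit t ^+ (t - 1) * (1 - hit t) ^+ (n - s - t)).
have le SU : (SU.1 \in F) && (SU.2 \in G SU.1) ->
    mu (fun A => all (block_test A) (reach_blocks [set u] SU.1 ++ coreach_blocks v SU.1 SU.2))
    <= c.
  case: SU => S U /=; rewrite !inE => /andP[/and3P[uS /eqP Ss vS] /and3P[vU US /eqP Ut]].
  rewrite sub1set in vU.
  have dUS : [disjoint U & S] by rewrite disjoints_subset.
  rewrite (mu_blocks arc_pr); last first.
    rewrite pairwise_cat disjoint_reach_blocks disjoint_coreach_blocks !andbT.
    apply/allrelP=> y z /mapP[w _ ->] /mapP[x]; rewrite mem_enum !inE negb_or => /andP[_ xS] -> /=.
    rewrite disjoint_subset; apply/subsetP=> -[a b]; rewrite !inE /= => /andP[aS _].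
    by apply: contra xS => /andP[/eqP<-].
  rewrite big_cat /=; apply: ler_pM.
  - exact: factors_ge0.
  - exact: factors_ge0.
  - by have := @reach_factors_le [set u] S; rewrite sub1set uS Ss cards1; apply.
  - by have := coreach_factors_le vU dUS; rewrite Ss Ut.
apply: le_trans (ler_sum _ le) _; rewrite sumr_const -[leLHS]mulr_natl.
have cF : (#|F| <= 'C(n - 1, s - 1))%N.
  apply: leq_trans (_ : _ <= #|[set S : {set T} | [&& [set u] \subset S, S \subset setT & #|S| == s]]|)%N _.
    apply/subset_leq_card/subsetP=> S; rewrite !inE sub1set subsetT.
    by case/and3P=> -> ->.
  by have := card_sets_through setT [set u] s; rewrite cardsT cards1.
have cG S : S \in F -> (#|G S| <= 'C(n - s - 1, t - 1))%N.
  rewrite inE => /and3P[_ /eqP <- _].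
  by have := card_sets_through (~: S) [set v] t; rewrite cards1 [#|~: S|]cardsCs setCK.
have cFG : (#|[pred SU : {set T} * {set T} | (SU.1 \in F) && (SU.2 \in G SU.1)]|
    <= 'C(n - 1, s - 1) * 'C(n - s - 1, t - 1))%N.
  rewrite -sum1_card -(pair_big_dep [in F] (fun S U => U \in G S) (fun _ _ => 1%N)) /=.
  apply: leq_trans (leq_mul cF (leqnn _)); rewrite -sum_nat_const; apply: leq_sum => S SF.
  by rewrite sum1_card cG.
apply: le_trans (_ : ('C(n - 1, s - 1) * 'C(n - s - 1, t - 1))%:R * c <= _).
  by rewrite ler_wpM2r ?ler_nat // !mulr_ge0 ?exprn_ge0 // subr_ge0.
rewrite natrM /c /binomial_weight (_ : (n - 1 - (s - 1) = n - s)%N); last by lia.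
rewrite (_ : (n - s - 1 - (t - 1) = n - s - t)%N); last by lia.
by rewrite le_eqVlt; apply/orP; left; apply/eqP; ring.
Qed.

End ArcMeasure.

(** * Comparison of the uniform model with independent arcs *)

Lemma binomial_mode (N m : nat) : (m <= N)%N ->
  (N ^ N <= N.+1 * ('C(N, m) * (m ^ m * (N - m) ^ (N - m))))%N.
Proof.
(* The [N.+1] terms [f i] add up to [N ^ N]; comparing neighbours shows that [f] increases up to [m]
   and decreases afterwards. *)
move=> mN; pose f i := ('C(N, i) * (m ^ i * (N - m) ^ (N - i)))%N.
have step i : (i < N)%N -> (i.+1 * f i.+1 * (N - m) = (N - i) * m * f i)%N.
  move=> iN; rewrite /f -(subnSK iN) !expnS.
  have := mul_bin_left N i; move: ('C(N, i.+1)) ('C(N, i)) => b' b e.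
  transitivity ((i.+1 * b') * (m * m ^ i * (N - m) ^ (N - i.+1) * (N - m)))%N; first by ring.
  by rewrite e (subnSK iN); ring.
have up i : (i < m)%N -> (f i <= f i.+1)%N.
  move=> im; have iN := leq_trans im mN.
  (* For [m = N] the factor [N - m] cannot be cancelled, but then [f i = 0]. *)
  case: (eqVneq m N) => [mE|mN']; first by rewrite /f mE subnn exp0n ?muln0 ?subn_gt0 // -mE.
  have mN2 : (m < N)%N by rewrite ltn_neqAle mN' mN.
  have Nm0 : (0 < i.+1 * (N - m))%N by rewrite muln_gt0 subn_gt0.
  rewrite -(leq_pmul2l Nm0) -[leqRHS]mulnA [((N - m) * _)%N]mulnC mulnA step // leq_mul2r.
  by apply/orP; right; rewrite mulnC leq_mul // leq_sub2l // ltnW.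
have down i : (m <= i < N)%N -> (f i.+1 <= f i)%N.
  case/andP=> mi iN; case: (posnP m) => [m0|m0].
    by rewrite /f m0 exp0n // muln0.
  have m0' : (0 < i.+1 * (N - m))%N by rewrite muln_gt0 subn_gt0 (leq_ltn_trans mi).
  rewrite -(leq_pmul2l m0') -[leqLHS]mulnA [((N - m) * _)%N]mulnC mulnA step // leq_mul2r.
  apply/orP; right; rewrite mulnC leq_mul //; first exact: leqW.
  exact: leq_sub2l.
have lo k : (f (m - k) <= f m)%N.
  elim: k => [|k IHk]; first by rewrite subn0.
  apply: leq_trans IHk; case: (leqP m k) => mk.
    by rewrite (eqP (leqW mk : (m - k.+1 == 0)%N)) (eqP (mk : (m - k == 0)%N)).
  have := up (m - k.+1)%N; rewrite (subnSK mk); apply.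
  exact: leq_subr.
have hi k : (m + k <= N)%N -> (f (m + k) <= f m)%N.
  elim: k => [|k IHk]; first by rewrite addn0.
  rewrite addnS => mkN; apply: leq_trans (IHk (ltnW mkN)).
  by apply: down; rewrite leq_addr mkN.
have le i : (i <= N)%N -> (f i <= f m)%N.
  case: (leqP i m) => [im _|/ltnW mi iN]; first by rewrite -(subKn im) lo.
  by have := hi (i - m)%N; rewrite subnKC //; apply.
rewrite -{1}(subnK mN) expnDn -[in leqRHS](card_ord N.+1) -sum_nat_const.
apply: leq_sum => i _; apply: leq_trans (le i (ltn_ord i)).
by rewrite /f [(m ^ i * _)%N]mulnC.
Qed.

Section Transfer.
Variables (R : realFieldType) (T : finType) (m : nat).
Let N := #|offdiag T|.
Hypotheses (N_gt0 : (0 < N)%N) (mN : (m <= N)%N).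
Let p : R := m%:R / N%:R.

Lemma arc_density01 : 0 <= p <= 1.
Proof.
have N0 : 0 < N%:R :> R by rewrite ltr0n.
by rewrite divr_ge0 //= ler_pdivrMr // mul1r ler_nat.
Qed.

Lemma weight_msets A : A \in msets (offdiag T) m ->
  weight (arc_pr p) A = p ^+ m * (1 - p) ^+ (N - m).
Proof.
rewrite inE => /andP[/subsetP AD /eqP Am]; rewrite /weight (bigID [in A]) /=; congr (_ * _).
  rewrite -Am -prodr_const; apply: eq_bigr => e eA.
  by rewrite eA /arc_pr AD.
rewrite (eq_bigr (fun e => 1 - arc_pr p e)) => [|e /negbTE-> //].
have := avoid_arc_pr p (~: A); rewrite /avoid_pr (_ : #|_| = N - m)%N => [<-|].
  by apply: eq_bigl => e; rewrite inE.
by rewrite setIC -setDE cardsD (setIidPr _) ?Am //; apply/subsetP.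
Qed.

(** All sets of [m] arcs have the same weight [w0], and having exactly [m] arcs has probability at
    least [1 / N.+1] because [m] is the mode. *)
Lemma msets_le_mu (P : pred {set T * T}) :
  #|[set A in msets (offdiag T) m | P A]|%:R <=
    'C(N, m)%:R * N.+1%:R * mu (arc_pr p) P.
Proof.
have N0 : 0 < N%:R :> R by rewrite ltr0n.
have p01 := arc_density01; have /andP[p0 p1] := p01.
pose w0 := p ^+ m * (1 - p) ^+ (N - m).
have w0_large : 1 <= 'C(N, m)%:R * N.+1%:R * w0.
  have := binomial_mode mN; rewrite -(ler_nat R) !natrM !natrX => mode.
  have -> : w0 = m%:R ^+ m * (N - m)%:R ^+ (N - m) / N%:R ^+ N.
    rewrite /w0 (_ : 1 - p = (N - m)%:R / N%:R); last first.
      by rewrite natrB // mulrBl divff // lt0r_neq0.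
    rewrite !expr_div_n mulrACA -invfM -exprD subnKC //.
  have NN : 0 < N%:R ^+ N :> R by rewrite exprn_gt0.
  rewrite mulrA ler_pdivlMr // mul1r (le_trans mode) //.
  by rewrite le_eqVlt; apply/orP; left; apply/eqP; ring.
apply: le_trans (_ : _ <= 'C(N, m)%:R * N.+1%:R * w0 * #|[set A in msets (offdiag T) m | P A]|%:R) _.
  by rewrite ler_peMl.
rewrite -[leLHS]mulrA ler_wpM2l ?mulr_ge0 // /mu mulr_natr -sumr_const.
rewrite big_mkcond [leRHS]big_mkcond; apply: ler_sum => A _; rewrite inE.
case: (boolP (A \in _)) => Am /=; case: ifP => // _.
  by rewrite weight_msets.
exact/weight_ge0/arc_pr01.
Qed.

End Transfer.

From mathcomp Require Import all_classical all_reals all_analysis.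

Import Order.TTheory GRing.Theory Num.Theory.
Import numFieldNormedType.Exports.

(** * Large deviation estimates *)

Section ExponentialBounds.
Variable R : realType.
Implicit Types (p q x y t lam : R) (n k s : nat).

Lemma expr_le_expR x n : 0 <= 1 + x -> (1 + x) ^+ n <= expR (x * n%:R).
Proof.
by move=> x0; rewrite expRM_natr lerXn2r ?nnegrE ?expR_ge0 // expR_ge1Dx.
Qed.

Lemma binomial_weight_expR n k q lam : 0 <= q <= 1 -> 0 < lam -> (k <= n)%N ->
  binomial_weight n k q <= lam^-1 ^+ k * expR ((lam - 1) * q * n%:R).
Proof.
move=> q01 lam0 kn; rewrite exprVn mulrC ler_pdivlMr ?exprn_gt0 //.
apply: le_trans (binomial_weight_tilted q01 lam0 kn) _.
have -> : 1 - q + lam * q = 1 + (lam - 1) * q by ring.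
apply: expr_le_expR; have /andP[q0 q1] := q01.
have -> : 1 + (lam - 1) * q = (1 - q) + lam * q by ring.
by rewrite addr_ge0 ?subr_ge0 // mulr_ge0 // ltW.
Qed.

(** Convexity: the tangent at [- (t * y)], evaluated at [0] and at [- y], gives [h1] and [h2], which
    are averaged with weights [1 - t] and [t]. *)
Lemma expR_chord t y : 0 <= t <= 1 -> expR (- (t * y)) <= 1 - t * (1 - expR (- y)).
Proof.
move=> /andP[t0 t1]; set E := expR (- (t * y)).
have E0 : 0 <= E by apply: expR_ge0.
have h1 : E * (1 + t * y) <= 1.
  by rewrite mulrC -ler_pdivlMr ?expR_gt0 // /E expRN invrK mul1r expR_ge1Dx.
have h2 : E * (1 - (1 - t) * y) <= expR (- y).
  have -> : - y = - (t * y) + (- ((1 - t) * y)) by ring.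
  by rewrite expRD ler_wpM2l // expR_ge1Dx.
have := lerD (ler_wpM2l t0 h2) (ler_wpM2l (_ : 0 <= 1 - t) h1).
rewrite subr_ge0 => /(_ t1); nra.
Qed.

Lemma hit_le p n : 0 <= p <= 1 -> hit p n <= p * n%:R.
Proof.
case/andP=> p0 p1; rewrite /hit; elim: n => [|n IHn].
  by rewrite expr0 subrr mulr0.
have : 0 <= (1 - p) ^+ n <= 1 by rewrite exprn_ge0 ?exprn_ile1 ?subr_ge0 ?lerBlDr ?lerDl.
by rewrite exprS -natr1; move: IHn; set z := (1 - p) ^+ n; nra.
Qed.

Lemma hit_ge p n : 0 <= p <= 1 -> 1 - expR (- (p * n%:R)) <= hit p n.
Proof.
case/andP=> p0 p1; rewrite /hit lerD2l lerN2 -mulNr.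
by apply: expr_le_expR; rewrite subr_ge0.
Qed.

Lemma fact_le_expR n x : 0 <= x -> x ^+ n / n`!%:R <= expR x.
Proof.
move=> x0; case: n => [|n]; first by rewrite expr0 fact0 divr1 -expR0 ler_expR.
by apply: le_trans (expR_ge1Dxn n x0); rewrite lerDr.
Qed.

Lemma bin_le_pow_fact n k : ('C(n, k)%:R : R) <= n%:R ^+ k / k`!%:R.
Proof.
rewrite ler_pdivlMr ?ltr0n ?fact_gt0 // -natrM -natrX ler_nat bin_ffact.
by elim: k => [|k IHk]; rewrite ?ffactn0 // ffactnSr expnSr leq_mul // leq_subr.
Qed.

End ExponentialBounds.

(** * Decay rates for forward growth and backward extinction *)

Section Supercritical.
Variables (R : realType) (a b : R).
Hypotheses (a_gt1 : 1 < a) (ab : a <= b) (gam_lt1 : b * expR (1 - a) < 1).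

(** An explicit lower stand-in for the survival probability of a Poisson branching process of mean
    [a], chosen so that [b * (1 - survival)] is the quantity assumed below 1. *)
Definition survival : R := 1 - expR (1 - a).

Lemma survival_gt0 : 0 < survival.
Proof. by rewrite /survival subr_gt0 expR_lt1 subr_lt0. Qed.

Lemma survival_lt1 : survival < 1.
Proof. by rewrite /survival gtrBl expR_gt0. Qed.

(* [survival] is a strict sub-solution of [x = 1 - exp (- a x)], so the
   number of vertices hit by [s] vertices exceeds [s] by a constant factor
   [growth] as long as [s <= survival * n]. *)
Definition growth : R := (1 - expR (- (a * survival))) / survival.

Lemma growth_gt1 : 1 < growth.
Proof.
rewrite /growth ltr_pdivlMr ?survival_gt0 // mul1r {1}/survival.
rewrite ltrD2l ltrN2 ltr_expR /survival.
have aE : a * expR (1 - a) < 1.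
  by apply: le_lt_trans gam_lt1; rewrite ler_wpM2r ?expR_ge0.
by rewrite mulrBr mulr1 opprB; move: aE; lra.
Qed.

(** The first entry is the cost per newly reached vertex, the second the cost per starting
    vertex. *)
Definition gap_rate : R := Num.max (growth * expR (1 - growth))
  (expR (- ((growth - 1) ^+ 2 / growth))).

Lemma gap_rate_gt0 : 0 < gap_rate.
Proof. by rewrite /gap_rate lt_max expR_gt0 orbT. Qed.

Lemma gap_rate_lt1 : gap_rate < 1.
Proof.
have g1 := growth_gt1; rewrite /gap_rate gt_max; apply/andP; split.
  rewrite -[1 - growth]opprB expRN ltr_pdivrMr ?expR_gt0 // mul1r.
  have := @expR_gt1Dx _ (growth - 1); rewrite subr_eq0 gt_eqF // => /(_ isT).
  by rewrite addrC subrK.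
by rewrite expR_lt1 oppr_lt0 divr_gt0 ?exprn_gt0 ?subr_gt0 //; lra.
Qed.

(** [growth] is the slope of the chord of [x |-> 1 - exp (- a x)] from [0] to [survival], and by
    concavity the curve lies above it. *)
Lemma hit_growth p n s : 0 <= p <= 1 -> a <= n%:R * p -> (0 < n)%N ->
  s%:R <= survival * n%:R -> growth * s%:R <= n%:R * hit p s.
Proof.
move=> p01 anp n0 sn; have g0 := survival_gt0.
have n0' : 0 < n%:R :> R by rewrite ltr0n.
pose t : R := s%:R / n%:R / survival.
have t01 : 0 <= t <= 1.
  apply/andP; split; first by rewrite /t !divr_ge0 // ltW.
  by rewrite /t ler_pdivrMr // mul1r ler_pdivrMr.
have := expR_chord (a * survival) t01.
have -> : t * (a * survival) = a * (s%:R / n%:R).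
  by rewrite /t; field; rewrite !gt_eqF.
move=> chord; rewrite [leRHS]mulrC -ler_pdivrMr //.
apply: le_trans (hit_ge s p01).
have le : expR (- (p * s%:R)) <= expR (- (a * (s%:R / n%:R))).
  rewrite ler_expR lerN2 mulrA ler_pdivrMr // [leRHS]mulrAC.
  by rewrite ler_wpM2r // mulrC.
have : 1 - t * (1 - expR (- (a * survival))) = 1 - s%:R / n%:R * growth.
  by rewrite /t /growth; field; rewrite !gt_eqF.
lra.
Qed.

(** Lower tail: the mean exceeds the value [s - k] by a factor at least [growth], so Chernoff's
    bound is used with tilt [growth^-1]. *)
Lemma gap_weight_le p n k s : 0 <= p <= 1 -> a <= n%:R * p -> (0 < n)%N ->
    (k <= s <= n)%N -> s%:R <= survival * n%:R ->
  binomial_weight (n - k) (s - k) (hit p s) <= gap_rate ^+ s.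
Proof.
move=> p01 anp n0 /andP[ks sn] sg; have g1 := growth_gt1.
have q01 := hit01 p01 s; have gg := hit_growth p01 anp n0 sg.
have g0 : 0 < growth by lra.
have g0' := ltW g0.
apply: le_trans (binomial_weight_expR (lam := growth^-1) q01 _ _) _.
- by rewrite invr_gt0.
- exact: leq_sub2r.
rewrite invrK.
have -> : (growth^-1 - 1) * hit p s * (n - k)%:R =
   - ((growth - 1) / growth * ((n - k)%:R * hit p s)) by field; rewrite gt_eqF.
(* From [n * hit p s >= growth * s] subtract [k * hit p s <= k]. *)
have lo : growth * (s - k)%:R + (growth - 1) * k%:R <= (n - k)%:R * hit p s.
  rewrite !natrB ?(leq_trans ks) //; have /andP[q0 q1] := q01.
  have k0 : 0 <= k%:R :> R by []. nra.
apply: le_trans (_ : _ <= growth ^+ (s - k) * expR (- ((growth - 1) / growth *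
    (growth * (s - k)%:R + (growth - 1) * k%:R)))) _.
  rewrite ler_wpM2l ?exprn_ge0 // ler_expR lerN2 ler_wpM2l //.
  by rewrite divr_ge0 // subr_ge0 ltW.
have -> : - ((growth - 1) / growth * (growth * (s - k)%:R + (growth - 1) * k%:R)) =
    (1 - growth) * (s - k)%:R + (- ((growth - 1) ^+ 2 / growth)) * k%:R.
  by field; rewrite gt_eqF.
rewrite expRD !expRM_natr mulrA -exprMn -[in leRHS](subnK ks) exprD.
have G0 := ltW gap_rate_gt0.
have gE : 0 <= growth * expR (1 - growth) by rewrite (mulr_ge0 g0') ?expR_ge0.
apply: ler_pM; rewrite ?(exprn_ge0 _ gE) ?(exprn_ge0 _ (expR_ge0 _)) //.
  by rewrite lerXn2r ?nnegrE // /gap_rate le_max lexx.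
by rewrite lerXn2r ?nnegrE ?expR_ge0 // /gap_rate le_max lexx orbT.
Qed.

(* Bounds [np (1 - survival)], the mean number of in-neighbours of a vertex
   outside a set of [survival * n] vertices. *)
Definition subcrit : R := b * expR (1 - a).

Lemma subcrit_gt0 : 0 < subcrit.
Proof. by rewrite mulr_gt0 ?expR_gt0 // (lt_trans ltr01) // (lt_le_trans a_gt1). Qed.

Definition link_rate : R := subcrit * expR (1 - subcrit).

Lemma link_rate_gt0 : 0 < link_rate.
Proof. by rewrite mulr_gt0 ?expR_gt0 ?subcrit_gt0. Qed.

Lemma link_rate_lt1 : link_rate < 1.
Proof.
rewrite /link_rate -[1 - _]opprB expRN ltr_pdivrMr ?expR_gt0 // mul1r.
have := @expR_gt1Dx _ (subcrit - 1); rewrite subr_eq0 lt_eqF // => /(_ isT).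
by rewrite addrC subrK.
Qed.

(** Upper tail: the mean is at most [subcrit * t], and the tilt is [subcrit^-1]. The divisor
    [subcrit] accounts for [t - 1] in place of [t]. *)
Lemma link_weight_le p n s t : 0 <= p <= 1 -> n%:R * p <= b ->
    survival * n%:R <= s%:R -> (s < n)%N -> (0 < t)%N -> (s + t <= n)%N ->
  binomial_weight (n - s - 1) (t - 1) (hit p t) <= link_rate ^+ t / subcrit.
Proof.
move=> p01 npb sg sn t0 stn; have c0 := subcrit_gt0; have c0' := ltW c0; have c1 : subcrit < 1 by [].
have /andP[p0 p1] := p01; have /andP[q0 q1] := hit01 p01 t.
apply: le_trans (binomial_weight_expR (lam := subcrit^-1) (hit01 p01 t) _ _) _.
- by rewrite invr_gt0.
- by rewrite leq_sub2r // leq_subRL // ltnW.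
rewrite invrK /link_rate (exprMn t subcrit) -expRM_natr.
have -> : subcrit ^+ t = subcrit ^+ (t - 1) * subcrit by rewrite -exprSr -addn1 subnK.
have simp u v : u * subcrit * v / subcrit = u * v.
  by rewrite mulrAC mulfK ?gt_eqF.
rewrite simp ler_wpM2l ?exprn_ge0 // ler_expR.
have ns : p * (n - s - 1)%:R <= subcrit.
  apply: le_trans (_ : p * ((1 - survival) * n%:R) <= _).
    have le1 : (n - s - 1)%:R <= (n - s)%:R :> R by rewrite ler_nat leq_subr.
    rewrite ler_wpM2l //; apply: le_trans le1 _.
    by rewrite natrB ?(ltnW sn) // mulrBl mul1r lerD2l lerN2.
  rewrite /subcrit (_ : 1 - survival = expR (1 - a)); last by rewrite /survival; ring.
  by rewrite mulrCA mulrC ler_wpM2r ?expR_ge0 // mulrC.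
have -> : (1 - subcrit) * t%:R = (subcrit^-1 - 1) * (subcrit * t%:R).
  by rewrite [RHS]mulrA [in RHS]mulrBl mulVf ?gt_eqF // mul1r.
rewrite -mulrA ler_wpM2l ?subr_ge0 ?invf_ge1 //; first exact: ltW.
apply: le_trans (_ : p * t%:R * (n - s - 1)%:R <= _).
  by rewrite ler_wpM2r // hit_le.
by rewrite mulrAC ler_wpM2r.
Qed.

End Supercritical.

(** * Fractions of bad arc sets in the uniform model *)

Section ArcFractions.
Variables (R : realType) (T : finType) (m : nat).
Let n := #|T|.
Let N := #|offdiag T|.
Let p : R := m%:R / N%:R.
Hypotheses (N_gt0 : (0 < N)%N) (mN : (m <= N)%N).

Definition fraction (P : pred {set T * T}) : R :=
  #|[set A in msets (offdiag T) m | P A]|%:R / 'C(N, m)%:R.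

Lemma bin_gt0R : 0 < 'C(N, m)%:R :> R.
Proof. by rewrite ltr0n bin_gt0. Qed.

Lemma fraction_or (P Q : pred {set T * T}) x y : fraction P <= x -> fraction Q <= y ->
  fraction [pred A : {set T * T} | P A || Q A] <= x + y.
Proof.
move=> Px Qy; apply: le_trans (lerD Px Qy).
rewrite -mulrDl ler_wpM2r ?invr_ge0 // -natrD ler_nat.
apply: leq_trans (leq_card_setU _ _); apply/subset_leq_card/fintype.subsetP=> A.
by rewrite !inE => /andP[-> /orP[]->]; rewrite ?orbT.
Qed.

Lemma fraction_transpose (P : pred {set T * T}) :
  fraction (fun A => P (transpose A)) = fraction P.
Proof. by rewrite /fraction card_msets_transpose. Qed.

Lemma fraction_le_mu (P : pred {set T * T}) :
  fraction P <= N.+1%:R * mu (arc_pr p) P.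
Proof.
rewrite ler_pdivrMr ?bin_gt0R // [leRHS]mulrC mulrA.
exact: msets_le_mu.
Qed.

(** The count gives [n * (n p) ^ k / k!], and [(2 n p) ^ k / k!] is at most [exp (2 n p)]. *)
Lemma fraction_large_outdegree (b : R) k : n%:R * p <= b -> (k <= m)%N ->
  fraction (@large_outdegree T k)
    <= n%:R * expR (2 * b) * 2^-1 ^+ k.
Proof.
move=> npb km; have N0 : 0 < N%:R :> R by rewrite ltr0n.
have p0 : 0 <= p by rewrite divr_ge0.
rewrite ler_pdivrMr ?bin_gt0R //.
have := @card_large_outdegree T m k; rewrite -(ler_nat R) => /le_trans; apply.
rewrite !natrM -!mulrA ler_wpM2l //.
have pres : ('C(N - k, m - k)%:R : R) <= p ^+ k * 'C(N, m)%:R.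
  have := bin_present_le km mN; rewrite -(ler_nat R) !natrM !natrX => h.
  by rewrite /p expr_div_n mulrAC ler_pdivlMr ?exprn_gt0.
apply: le_trans (ler_wpM2l (ler0n _ _) pres) _; rewrite [leLHS]mulrA [leRHS]mulrA.
rewrite ler_wpM2r //; apply: le_trans (ler_wpM2r (exprn_ge0 _ p0) (bin_le_pow_fact R n k)) _.
rewrite mulrAC -exprMn exprVn ler_pdivlMr ?exprn_gt0 // mulrAC -exprMn.
have x0 : 0 <= n%:R * p * 2 by rewrite !mulr_ge0.
apply: le_trans (fact_le_expR k x0) _; rewrite ler_expR mulrC.
by rewrite ler_wpM2l.
Qed.

(** Absent arcs cost [exp (- a s)] and [s ^ s / s!] is at most [exp s], so the term is at most
    [s ^ 2] times [(b * exp (1 - a)) ^ s]. *)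
Lemma excess_term_le (a b : R) s : n%:R * p <= b -> b * expR (1 - a) <= 1 ->
    (s <= m)%N -> (s < N)%N -> (s <= n)%N ->
    a * N%:R <= (n - s)%:R * (m - s)%:R ->
  ('C(n, s) * (s ^ s.+2 * 'C(N - s - s * (n - s), m - s)))%:R
    <= s%:R ^+ 2 * 'C(N, m)%:R :> R.
Proof.
move=> npb crit sm sN sn aN; have N0 : 0 < N%:R :> R by rewrite ltr0n.
have p0 : 0 <= p by rewrite divr_ge0.
have Ns0 : 0 < (N - s)%:R :> R by rewrite ltr0n subn_gt0.
have bin_le : ('C(N - s - s * (n - s), m - s)%:R : R)
    <= p ^+ s * expR (- (a * s%:R)) * 'C(N, m)%:R.
  have := bin_constrained_le (s * (n - s)) sm mN; rewrite -(ler_nat R) !natrM !natrX => h.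
  have {}h : ('C(N - s - s * (n - s), m - s)%:R : R) <=
      p ^+ s * ((N - m)%:R / (N - s)%:R) ^+ (s * (n - s)) * 'C(N, m)%:R.
    have -> : p ^+ s * ((N - m)%:R / (N - s)%:R) ^+ (s * (n - s)) * 'C(N, m)%:R =
        m%:R ^+ s * (N - m)%:R ^+ (s * (n - s)) * 'C(N, m)%:R /
        (N%:R ^+ s * (N - s)%:R ^+ (s * (n - s))).
      by rewrite /p !expr_div_n invfM; ring.
    by rewrite ler_pdivlMr // mulr_gt0 ?exprn_gt0.
  apply: le_trans h _; rewrite ler_wpM2r // ler_wpM2l ?exprn_ge0 //.
  have -> : (N - m)%:R / (N - s)%:R = 1 + - ((m - s)%:R / (N - s)%:R) :> R.
    by rewrite !natrB // ?(ltnW sN) //; field; rewrite -natrB ?(ltnW sN) // gt_eqF.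
  apply: le_trans (expr_le_expR _ _) _.
    by rewrite subr_ge0 ler_pdivrMr // mul1r ler_nat leq_sub2r.
  rewrite ler_expR mulNr lerN2 natrM.
  apply: le_trans (_ : (m - s)%:R / N%:R * (s%:R * (n - s)%:R) <= _); last first.
    by rewrite ler_wpM2r ?mulr_ge0 // ler_wpM2l // lef_pV2 ?posrE // ler_nat leq_subr.
  have -> : (m - s)%:R / N%:R * (s%:R * (n - s)%:R) =
      s%:R * ((n - s)%:R * (m - s)%:R / N%:R) :> R by ring.
  by rewrite mulrC ler_wpM2l // ler_pdivlMr.
have e_le : s%:R ^+ s / s`!%:R <= expR 1 ^+ s :> R.
  by rewrite -expRM_natl mulr1 fact_le_expR.
rewrite natrM [X in _ * X]natrM natrX mulrA.
apply: le_trans (ler_wpM2l _ bin_le) _; first by rewrite mulr_ge0 ?exprn_ge0.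
rewrite mulrA ler_wpM2r //.
apply: le_trans (_ : n%:R ^+ s / s`!%:R * s%:R ^+ s.+2 * (p ^+ s * expR (- (a * s%:R))) <= _).
  by rewrite ler_wpM2r ?mulr_ge0 ?exprn_ge0 ?expR_ge0 // ler_wpM2r ?exprn_ge0 ?bin_le_pow_fact.
have -> : n%:R ^+ s / s`!%:R * s%:R ^+ s.+2 * (p ^+ s * expR (- (a * s%:R))) =
   s%:R ^+ 2 * ((n%:R * p) ^+ s * (s%:R ^+ s / s`!%:R) * expR (- a) ^+ s).
  by rewrite -expRM_natr mulNr (exprMn s n%:R p) !exprS expr0; ring.
rewrite -[leRHS]mulr1 ler_wpM2l ?exprn_ge0 //.
apply: le_trans (_ : b ^+ s * expR 1 ^+ s * expR (- a) ^+ s <= _).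
  rewrite ler_wpM2r ?exprn_ge0 ?expR_ge0 // ler_pM ?exprn_ge0 ?divr_ge0 ?exprn_ge0 ?mulr_ge0 //.
  by rewrite lerXn2r ?nnegrE ?mulr_ge0 // (le_trans _ npb) ?mulr_ge0.
have b0 : 0 <= b by rewrite (le_trans _ npb) ?mulr_ge0.
rewrite -!exprMn -mulrA -expRD exprn_ile1 // ?mulr_ge0 ?expR_ge0 //.
Qed.

(** Each of the [L + 1 <= 2 * L] terms is at most [L ^ 2]; Markov's inequality divides by [M]. *)
Lemma fraction_many_excess (a b : R) L M : n%:R * p <= b -> b * expR (1 - a) <= 1 ->
    (0 < L)%N -> (L <= m)%N -> (L < N)%N -> (L <= n)%N ->
    a * N%:R <= (n - L)%:R * (m - L)%:R -> (0 < M)%N ->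
  fraction (@many_excess T L M) <= 2 * L%:R ^+ 3 / M%:R.
Proof.
move=> npb crit L0 Lm LN Ln aN M0.
have M0' : 0 < M%:R :> R by rewrite ltr0n.
rewrite ler_pdivrMr ?bin_gt0R // mulrAC ler_pdivlMr // -natrM.
have := @card_many_excess T m L M; rewrite -(ler_nat R) => /le_trans; apply.
rewrite natr_sum; apply: le_trans (_ : \sum_(s < L.+1) L%:R ^+ 2 * 'C(N, m)%:R <= _).
  apply: ler_sum => s _; have sL : (s <= L)%N by rewrite -ltnS.
  apply: le_trans (@excess_term_le a b s npb crit _ _ _ _) _.
  - exact: leq_trans Lm.
  - exact: leq_ltn_trans LN.
  - exact: leq_trans Ln.
  - by apply: le_trans aN _; rewrite ler_pM // ler_nat leq_sub2l.
  by rewrite ler_wpM2r // lerXn2r ?nnegrE // ler_nat.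
rewrite sumr_const card_ord -[leLHS]mulr_natl mulrA ler_wpM2r //.
rewrite [in leRHS]exprS [leRHS]mulrA ler_wpM2r ?exprn_ge0 // -natrM ler_nat mul2n -addnn -addn1.
by rewrite leq_add2l.
Qed.

Section Supercritical.
Variables (a b : R) (L s0 : nat).
Hypotheses (a_gt1 : 1 < a) (ab : a <= b) (crit : b * expR (1 - a) < 1).
Hypotheses (anp : a <= n%:R * p) (npb : n%:R * p <= b) (n_gt0 : (0 < n)%N).
Hypothesis s0_gap : forall s, (s < s0)%N = (s%:R <= survival a * n%:R).

Let p01 : 0 <= p <= 1. Proof. exact: arc_density01. Qed.

Lemma mu_gap (X : {set T}) :
  mu (arc_pr p) [pred A : {set T * T} | (L < #|reach_from A X| < s0)%N] <= n.+1%:R * gap_rate a ^+ L.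
Proof.
have r0 := ltW (gap_rate_gt0 a); have r1 := ltW (gap_rate_lt1 a_gt1 ab crit).
pose I := [pred s : 'I_n.+1 | (L < s < s0)%N].
have cov A : (L < #|reach_from A X| < s0)%N ->
    exists2 s : 'I_n.+1, I s & #|reach_from A X| == s.
  move=> h; have lt : (#|reach_from A X| < n.+1)%N by rewrite ltnS max_card.
  by exists (Ordinal lt).
apply: le_trans (mu_union (arc_pr01 p01) cov) _.
have le s : I s -> mu (arc_pr p) (fun A => #|reach_from A X| == s) <= gap_rate a ^+ L.
  case/andP=> Ls ss0; apply: le_trans (_ : gap_rate a ^+ s <= _); last first.
    by rewrite ler_wiXn2l // ltnW.
  case: (leqP #|X| s) => Xs.
    apply: le_trans (mu_reach_card p01 Xs) _.
    apply: (gap_weight_le a_gt1 ab crit p01) => //; last by rewrite -s0_gap.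
    by rewrite Xs -ltnS ltn_ord.
  (* Sizes below [#|X|] cannot occur, since [X] is part of what it reaches. *)
  rewrite /mu big_pred0 ?exprn_ge0 // => A; apply/negbTE; apply: contraL Xs => /eqP<-.
  by rewrite -leqNgt subset_leq_card ?sub_reach_from.
apply: le_trans (ler_sum _ le) _; rewrite sumr_const -[leLHS]mulr_natl.
rewrite ler_wpM2r ?exprn_ge0 // ler_nat.
by rewrite -[leqRHS]card_ord max_card.
Qed.

Lemma fraction_gap :
  fraction (@has_gap T L s0) <=
    N.+1%:R * (n%:R * (n.+1%:R * gap_rate a ^+ L)).
Proof.
apply: le_trans (fraction_le_mu _) _; rewrite ler_wpM2l //.
apply: le_trans (mu_union (I := T) (Q := predT)
  (P := fun u => [pred A : {set T * T} | (L < #|reach_from A [set u]| < s0)%N]) (arc_pr01 p01) _) _.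
  by move=> A /existsP[u hu]; exists u => //=; rewrite reach_from1.
apply: le_trans (ler_sum _ (fun u _ => mu_gap [set u])) _.
by rewrite sumr_const [leRHS]mulr_natl.
Qed.

Lemma fraction_gap_initial :
  fraction (@has_initial_gap T L s0) <=
    N.+1%:R * (n.+1%:R * (n.+1%:R * gap_rate a ^+ L)).
Proof.
apply: le_trans (fraction_le_mu _) _; rewrite ler_wpM2l //.
apply: le_trans (mu_union (I := 'I_n.+1) (Q := predT)
  (P := fun k => [pred A : {set T * T} | (L < #|reach_from A (initial_set T k)| < s0)%N]) (arc_pr01 p01) _) _.
  by move=> A /existsP[u hu]; exists u.
apply: le_trans (_ : \sum_(k < n.+1) (n.+1%:R * gap_rate a ^+ L) <= _).
  by apply: ler_sum => k _; apply: mu_gap.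
by rewrite sumr_const card_ord [leRHS]mulr_natl.
Qed.

(** Sum over the sizes of both sets. The forward factor is bounded by 1; the decay comes from the
    backward exploration alone. *)
Lemma mu_unlinked_pair u v :
  mu (arc_pr p) (fun A : {set T * T} => unlinked L s0 A u v) <=
    n.+1%:R ^+ 2 * (link_rate a b ^+ L / subcrit a b).
Proof.
have c0 := subcrit_gt0 a_gt1 ab; have r0 := ltW (link_rate_gt0 a_gt1 ab).
have r1 := ltW (link_rate_lt1 crit).
have B0 : 0 <= link_rate a b ^+ L / subcrit a b by rewrite divr_ge0 ?(exprn_ge0 _ r0) // ltW.
pose I := [pred st : 'I_n.+1 * 'I_n.+1 | (s0 <= st.1)%N && (L < st.2)%N].
have cov (A : {set T * T}) : unlinked L s0 A u v -> exists2 st : 'I_n.+1 * 'I_n.+1, I st &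
    [&& #|reach A u| == st.1, #|coreach A v| == st.2 & v \notin reach A u].
  case/and3P=> hs ht vN.
  have lts : (#|reach A u| < n.+1)%N by rewrite ltnS max_card.
  have ltt : (#|coreach A v| < n.+1)%N by rewrite ltnS max_card.
  by exists (Ordinal lts, Ordinal ltt); rewrite /= ?hs ?ht // !eqxx.
apply: le_trans (mu_union (arc_pr01 p01) cov) _.
have le st : I st -> mu (arc_pr p)
    (fun A => [&& #|reach A u| == st.1, #|coreach A v| == st.2 & v \notin reach A u])
    <= link_rate a b ^+ L / subcrit a b.
  case: st => s t /= /andP[ss0 Lt].
  have t0 : (0 < t)%N by apply: leq_trans Lt.
  have sg : survival a * n%:R < s%:R by rewrite ltNge -s0_gap -leqNgt.
  have s_gt0 : (0 < s)%N.
    rewrite -(ltr0n R); apply: le_lt_trans sg.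
    by rewrite mulr_ge0 // ltW // survival_gt0.
  case: (leqP (s + t) n) => stn; last first.
    (* The two sets are disjoint, so their sizes cannot add up to more than [n]. *)
    rewrite /mu big_pred0 // => A; apply/negbTE; apply: contraL stn => /and3P[/eqP <- /eqP <- vN].
    rewrite -leqNgt -(_ : #|reach A u :|: coreach A v| = #|reach A u| + #|coreach A v|)%N ?max_card //.
    rewrite cardsU (_ : _ :&: _ = finset.set0) ?cards0 ?subn0 //; apply/setP=> x; rewrite !inE in vN *.
    by apply: contraNF vN => /andP[]; apply: connect_trans.
  have sn : (s < n)%N by apply: leq_trans stn; rewrite -addn1 leq_add2l.
  apply: le_trans (mu_unlinked p01 u v s_gt0 t0) _.
  rewrite -[leRHS]mul1r ler_pM ?binomial_weight_ge0 ?hit01 //.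
    by rewrite binomial_weight_le1 ?hit01 // leq_sub2r // ltnW.
  apply: le_trans (link_weight_le a_gt1 ab crit p01 npb (ltW sg) sn t0 stn) _.
  rewrite ler_wpM2r ?invr_ge0 ?(ltW c0) //.
  by rewrite ler_wiXn2l // ltnW.
apply: le_trans (ler_sum _ le) _; rewrite sumr_const -[leLHS]mulr_natl.
rewrite ler_wpM2r // -natrX ler_nat.
by apply: leq_trans (max_card _) _; rewrite card_prod card_ord.
Qed.

Lemma fraction_unlinked :
  fraction (@has_unlinked T L s0) <=
    N.+1%:R * (n%:R * (n%:R * (n.+1%:R ^+ 2 * (link_rate a b ^+ L / subcrit a b)))).
Proof.
apply: le_trans (fraction_le_mu _) _; rewrite ler_wpM2l //.
apply: le_trans (mu_union (I := T) (Q := predT)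
  (P := fun u => [pred A : {set T * T} | [exists v, unlinked L s0 A u v]]) (arc_pr01 p01) _) _.
  by move=> A /existsP[u hu]; exists u.
apply: le_trans (_ : \sum_(u : T) (n%:R * (n.+1%:R ^+ 2 * (link_rate a b ^+ L / subcrit a b))) <= _); last first.
  by rewrite sumr_const [leRHS]mulr_natl.
apply: ler_sum => u _.
apply: le_trans (mu_union (I := T) (Q := predT)
  (P := fun v => fun A : {set T * T} => unlinked L s0 A u v) (arc_pr01 p01) _) _.
  by move=> A /existsP[v hv]; exists v.
apply: le_trans (ler_sum _ (fun v _ => mu_unlinked_pair u v)) _.
by rewrite sumr_const [leRHS]mulr_natl.
Qed.

End Supercritical.
End ArcFractions.

Local Open Scope classical_set_scope.

(** * Asymptotics *)

(* Base 4 only serves to get [log4 n <= ln n]. *)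
Definition log4 (n : nat) : nat := trunc_log 4 n.

Section Asymptotics.
Variable R : realType.

Lemma expR1_le4 : expR 1 <= 4 :> R.
Proof.
have h : (2^-1 : R) <= expR (- 2^-1).
  by apply: le_trans (expR_ge1Dx _); lra.
have -> : (1 : R) = 2%:R * 2^-1 by rewrite divff.
rewrite expRM_natl; have e0 := expR_gt0 (2^-1 : R).
have : expR 2^-1 * expR (- 2^-1) = 1 :> R by rewrite -expRD subrr expR0.
rewrite expr2; nra.
Qed.

Lemma expR_log4_le n : (0 < n)%N -> expR (log4 n)%:R <= n%:R :> R.
Proof.
move=> n0; rewrite -[(log4 n)%:R]mulr1 expRM_natl.
apply: le_trans (_ : 4 ^+ log4 n <= _).
  by rewrite lerXn2r ?nnegrE ?expR_ge0 ?expR1_le4.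
by rewrite -natrX ler_nat trunc_logP.
Qed.

Lemma log4_le_ln n : (0 < n)%N -> (log4 n)%:R <= ln n%:R :> R.
Proof.
move=> n0; rewrite -[leLHS]expRK ler_ln ?posrE ?expR_gt0 ?ltr0n //.
exact: expR_log4_le.
Qed.

Lemma log4_unbounded k : \forall n \near \oo, (k <= log4 n)%N.
Proof.
by exists (4 ^ k)%N => // n /= h; apply: trunc_log_max.
Qed.

(** With [l = log4 n], [n] is at least [exp l], hence at least [l ^ d.+1 / d.+1!]; the spare factor
    [l] absorbs [K * d.+1!]. *)
Lemma log4_sublinear (K : R) d : \forall n \near \oo, K * (log4 n)%:R ^+ d <= n%:R.
Proof.
have h := log4_unbounded (Num.truncn (K * (d.+1)`!%:R)).+1.
near=> n; have lk : (Num.truncn (K * (d.+1)`!%:R) < log4 n)%N by near: n.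
have n0 : (0 < n)%N by near: n; exists 1%N.
apply: le_trans (expR_log4_le n0).
apply: le_trans (fact_le_expR d.+1 (ler0n _ _)).
rewrite exprSr -mulrA [leLHS]mulrC ler_wpM2l ?exprn_ge0 //.
rewrite ler_pdivlMr ?ltr0n ?fact_gt0 //.
by rewrite ltW // (lt_le_trans (truncnS_gt _)) // ler_nat.
Unshelve. all: by end_near. Qed.

(** Since [n <= 4 ^ (2 l)], the product is at most [(4 ^ (2 d) * rho ^ l) ^ l], whose base is at
    most 1 once [l] is large. This is why [L] is the square of the logarithm. *)
Lemma pow_mul_rate_le1 (rho : R) d : 0 <= rho -> rho < 1 ->
  \forall n \near \oo, n%:R ^+ d * rho ^+ (log4 n ^ 2) <= 1.
Proof.
move=> rho0 rho1.
have [k hk] : exists k, rho ^+ k * (4 ^ (2 * d))%:R <= 1.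
  have B0 : 0 < (4 ^ (2 * d))%:R :> R by rewrite ltr0n expn_gt0.
  have cv := @cvg_expr R rho; rewrite ger0_norm // in cv.
  have B0' : 0 < (4 ^ (2 * d))%:R^-1 :> R by rewrite invr_gt0.
  have [k _ hk] := cvgr_lt _ (cv rho1) _ B0'; exists k.
  by rewrite -ler_pdivlMr // mul1r ltW // hk /=.
near=> n; have kl : (k <= log4 n)%N by near: n; apply: log4_unbounded.
have l1 : (1 <= log4 n)%N by near: n; apply: log4_unbounded.
have nl : n%:R <= (4 ^ (2 * log4 n))%:R :> R.
  rewrite ler_nat ltnW // (leq_trans (trunc_log_ltn n (isT : 1 < 4)%N)) //.
  by rewrite leq_exp2l // -/(log4 n) mul2n -addnn -addn1 leq_add2l.
apply: le_trans (_ : ((4 ^ (2 * d))%:R * rho ^+ log4 n) ^+ log4 n <= _).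
  rewrite exprMn -exprM mulnn ler_wpM2r ?exprn_ge0 //.
  apply: le_trans (_ : (4 ^ (2 * log4 n))%:R ^+ d <= _).
    by rewrite lerXn2r ?nnegrE.
  by rewrite -!natrX ler_nat -!expnM mulnAC.
rewrite exprn_ile1 ?mulr_ge0 ?exprn_ge0 // mulrC; apply: le_trans hk.
by rewrite ler_wpM2r // ler_wiXn2l // ltW.
Unshelve. all: by end_near. Qed.

End Asymptotics.

(** * Total fraction of bad arc sets *)

Section BadFraction.
Variables (R : realType) (T : finType) (m : nat).
Let n := #|T|.
Let N := #|offdiag T|.
Let p : R := m%:R / N%:R.

(** With [N + 1 <= n ^ 2], the gap bounds are of order [n ^ 4] and the link bound of order [n ^ 6]
    times their rates; one more power of [n] leaves [1 / n]. The excess bound is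
    [2 l ^ 6 / (l ^ 8 + 1)]. *)
Lemma fraction_bad_le (a b : R) (l s0 : nat) :
  (0 < N)%N -> (m <= N)%N -> 1 < a -> a <= b -> b * expR (1 - a) < 1 ->
  a <= n%:R * p -> n%:R * p <= b -> (0 < n)%N ->
  (forall s, (s < s0)%N = (s%:R <= survival a * n%:R)) ->
  (0 < l)%N -> (l ^ 2 < m)%N -> (l ^ 2 <= n)%N ->
  a * N%:R <= (n - l ^ 2)%:R * (m - l ^ 2)%:R ->
  n%:R ^+ 5 * gap_rate a ^+ (l ^ 2) <= 1 ->
  n%:R ^+ 7 * link_rate a b ^+ (l ^ 2) <= 1 ->
  n%:R ^+ 2 * 2^-1 ^+ (l ^ 2) <= 1 :> R ->
  fraction R m (@bad_arcs T (l ^ 2) s0 (l ^ 8)) <=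
    (8 + 4 / subcrit a b + 2 * expR (2 * b)) / n%:R + 4 / l%:R.
Proof.
move=> N0 mN a1 ab crit anp npb n0 s0g l0 lm ln aN h1 h2 h3.
have L0 : (0 < l ^ 2)%N by rewrite expn_gt0 l0.
have LN : (l ^ 2 < N)%N by apply: leq_trans mN.
have n0' : 0 < n%:R :> R by rewrite ltr0n.
have n1 : 1 <= n%:R :> R by rewrite ler1n.
have l0' : 0 < l%:R :> R by rewrite ltr0n.
have f1 := fraction_gap N0 mN (l ^ 2)%N a1 ab crit anp n0 s0g.
have f2 := fraction_gap_initial N0 mN (l ^ 2)%N a1 ab crit anp n0 s0g.
have f3 := fraction_unlinked N0 mN (l ^ 2)%N a1 ab crit npb s0g.
have f4 := @fraction_large_outdegree R T m N0 mN b (l ^ 2).+1 npb lm.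
have f5 := @fraction_many_excess R T m N0 mN a b (l ^ 2) (l ^ 8).+1 npb (ltW crit) L0
  (ltnW lm) LN ln aN isT.
have f4' := f4; rewrite -fraction_transpose in f4'.
have f5' := f5; rewrite -fraction_transpose in f5'.
have Nn : N.+1%:R <= n%:R ^+ 2 :> R.
  have sq k : (0 < k)%N -> ((k * k.-1).+1 <= k ^ 2)%N.
    by case: k => // k _; rewrite -mulnn mulnS addSn ltnS leq_addl.
  by rewrite -natrX ler_nat /N card_offdiag sq.
have n2 : n.+1%:R <= 2 * n%:R :> R by rewrite -natr1; lra.
set r := gap_rate a ^+ (l ^ 2) in f1 f2 h1 *.
set q := link_rate a b ^+ (l ^ 2) in f3 h2 *.
set z : R := 2^-1 ^+ (l ^ 2) in h3 *.
have r0 : 0 <= r by rewrite exprn_ge0 // ltW // gap_rate_gt0.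
have q0 : 0 <= q by rewrite exprn_ge0 // ltW // link_rate_gt0.
have z0 : 0 <= z by rewrite exprn_ge0.
have c0 := subcrit_gt0 a1 ab.
have x0 : 0 <= n%:R :> R by [].
have g1 : fraction R m (@has_gap T (l ^ 2) s0) <= 4 / n%:R.
  apply: le_trans f1 _; rewrite ler_pdivlMr //.
  apply: le_trans (_ : n%:R ^+ 2 * (n%:R * (2 * n%:R * r)) * n%:R <= _).
    by rewrite ler_wpM2r // !ler_pM ?mulr_ge0.
  have -> : n%:R ^+ 2 * (n%:R * (2 * n%:R * r)) * n%:R = 2 * (n%:R ^+ 5 * r) by ring.
  lra.
have g2 : fraction R m (@has_initial_gap T (l ^ 2) s0) <= 4 / n%:R.
  apply: le_trans f2 _; rewrite ler_pdivlMr //.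
  apply: le_trans (_ : n%:R ^+ 2 * (2 * n%:R * (2 * n%:R * r)) * n%:R <= _).
    by rewrite ler_wpM2r // !ler_pM ?mulr_ge0.
  have -> : n%:R ^+ 2 * (2 * n%:R * (2 * n%:R * r)) * n%:R = 4 * (n%:R ^+ 5 * r) by ring.
  lra.
have g3 : fraction R m (@has_unlinked T (l ^ 2) s0) <= 4 / subcrit a b / n%:R.
  apply: le_trans f3 _; rewrite ler_pdivlMr //.
  have qc : 0 <= q / subcrit a b by rewrite divr_ge0 // ltW.
  apply: le_trans (_ : n%:R ^+ 2 * (n%:R * (n%:R * ((2 * n%:R) ^+ 2 * (q / subcrit a b)))) * n%:R <= _).
    have sq2 : n.+1%:R ^+ 2 <= (2 * n%:R) ^+ 2 :> R.
      by rewrite lerXn2r ?nnegrE // mulr_ge0.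
    rewrite ler_wpM2r //; apply: ler_pM => //; first by do 2!(rewrite mulr_ge0 //); rewrite mulr_ge0 // exprn_ge0.
    by do 2!(rewrite ler_wpM2l //); rewrite ler_wpM2r.
  have -> : n%:R ^+ 2 * (n%:R * (n%:R * ((2 * n%:R) ^+ 2 * (q / subcrit a b)))) * n%:R
     = (n%:R ^+ 7 * q) * (4 / subcrit a b) by ring.
  by rewrite ler_piMl // divr_ge0 // ltW.
have g4 : n%:R * expR (2 * b) * 2^-1 ^+ (l ^ 2).+1 <= expR (2 * b) / n%:R.
  rewrite ler_pdivlMr // exprS -/z.
  have -> : n%:R * expR (2 * b) * (2^-1 * z) * n%:R = (n%:R ^+ 2 * z) * (expR (2 * b) / 2) by ring.
  have e0 := expR_gt0 (2 * b).
  apply: le_trans (_ : 1 * (expR (2 * b) / 2) <= _); last by lra.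
  by rewrite ler_wpM2r // divr_ge0 // ltW.
have g5 : 2 * (l ^ 2)%:R ^+ 3 / (l ^ 8).+1%:R <= 2 / l%:R :> R.
  rewrite ler_pdivrMr ?ltr0n // mulrAC ler_pdivlMr // -mulrA ler_wpM2l //.
  rewrite -natrX -natrM ler_nat -expnM -expnSr.
  by rewrite (leq_trans _ (leqnSn _)) // leq_pexp2l.
have le := fraction_or g1 (fraction_or g2 (fraction_or g3 (fraction_or (le_trans f4 g4)
  (fraction_or (le_trans f4' g4) (fraction_or (le_trans f5 g5) (le_trans f5' g5)))))).
have {}le : fraction R m (@bad_arcs T (l ^ 2) s0 (l ^ 8)) <= _ := le.
apply: le_trans le _; rewrite le_eqVlt; apply/orP; left; apply/eqP; ring.
Qed.

End BadFraction.

Lemma Pr_D_bounds (R : realType) (n m : nat) (E : pred (digraph 'I_n))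
    (bad : pred {set 'I_n * 'I_n}) :
    (m <= #|offdiag 'I_n|)%N ->
    (forall G, vertices G = [set: 'I_n]%SET -> ~~ bad (arcs G) -> E G) ->
  1 - fraction R m bad <= Pr_D R m E <= 1.
Proof.
move=> mN goodE; have C0 := bin_gt0R R mN.
have := card_good_digraphs m goodE.
rewrite /Pr_D /fraction -card_digraphs_nm in C0 *.
rewrite -(ler_nat R) natrD => le; apply/andP; split.
  by rewrite lerBlDr -mulrDl ler_pdivlMr // mul1r.
rewrite ler_pdivrMr // mul1r ler_nat; apply/subset_leq_card/fintype.subsetP=> G.
by rewrite inE => /andP[].
Qed.

(** [c < exp (c - 1)] is strict, so it survives a small perturbation of both occurrences of [c]. *)
Lemma subcritical_window (R : realType) (c : R) : 1 < c ->
  exists a b : R, [/\ 1 < a, a < c, c < b & b * expR (1 - a) < 1].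
Proof.
move=> c1; have E1 : c < expR (c - 1).
  have := @expR_gt1Dx _ (c - 1); rewrite subr_eq0 gt_eqF // => /(_ isT).
  by rewrite addrC subrK.
set E := expR (c - 1) in E1.
(* The first entry keeps [c - d] above 1; the second gives [c + d < E * (1 - d)], which is at most
   [exp (c - 1 - d)]. *)
pose d := Num.min ((c - 1) / 2) ((E - c) / (2 * (1 + E))).
have E0 : 0 < 1 + E by lra.
have d1 : d <= (c - 1) / 2 by rewrite /d ge_min lexx.
have d2 : d <= (E - c) / (2 * (1 + E)) by rewrite /d ge_min lexx orbT.
have d0 : 0 < d.
  by rewrite /d lt_min !divr_gt0 ?subr_gt0 // mulr_gt0.
have {}d2 : d * (1 + E) < E - c.
  have : d * (2 * (1 + E)) <= E - c by rewrite -ler_pdivlMr // mulr_gt0.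
  have := mulr_gt0 d0 E0; lra.
exists (c - d), (c + d); split; [lra|lra|lra|].
have -> : 1 - (c - d) = - (c - 1 - d) by ring.
rewrite expRN ltr_pdivrMr ?expR_gt0 // mul1r expRD -/E.
have := expR_ge1Dx (- d); have e0 := expR_gt0 (c - 1); rewrite -/E in e0 => h.
have : E * (1 - d) <= E * expR (- d) by rewrite ler_pM2l.
lra.
Qed.

Lemma density_ge (R : realFieldType) (a k x : R) :
  0 <= a -> a <= k -> 1 < x -> a <= k * x / (x - 1).
Proof. by move=> a0 ak x1; rewrite ler_pdivlMr ?subr_gt0 //; nra. Qed.

Lemma density_le (R : realFieldType) (b b' k x : R) :
  k <= b' -> b' < b -> b / (b - b') <= x -> 1 < x -> k * x / (x - 1) <= b.
Proof.
move=> kb' b'b bx x1; rewrite ler_pdivrMr ?subr_gt0 //.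
by rewrite ler_pdivrMr ?subr_gt0 // in bx; nra.
Qed.

(** Here [x] stands for [n], [k] for [c_ n] and [y] for [L]: removing [L] vertices and [L] arcs
    costs a term linear in [x], covered by [(a' - a) * x ^ 2]. *)
Lemma density_shrunk_ge (R : realFieldType) (a a' k x y : R) :
    0 <= a -> a < a' -> a' <= k -> 0 <= y -> 2 * y <= x ->
    (1 + a') / (a' - a) * y <= x ->
  a * (x * (x - 1)) <= (x - y) * (k * x - y).
Proof.
move=> a0 aa' a'k y0 yx L1; have x0 : 0 <= x by lra.
have {}L1 : (1 + a') * y <= (a' - a) * x.
  by rewrite [leRHS]mulrC -ler_pdivrMr ?subr_gt0 // mulrAC.
apply: le_trans (_ : (x - y) * (a' * x - y) <= _); last first.
  by rewrite ler_wpM2l ?lerD2r ?ler_wpM2r // subr_ge0; lra.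
have xL1 := ler_wpM2l x0 L1; have yy : 0 <= y * y by rewrite mulr_ge0.
have ax : 0 <= a * x by rewrite mulr_ge0.
nra.
Qed.

Lemma card_offdiag_ord n : #|offdiag 'I_n| = (n * n.-1)%N.
Proof. by rewrite card_offdiag card_ord. Qed.

(** * Passage to the limit *)

Section Limit.
Variables (R : realType) (c : R) (c_ : nat -> R) (m : nat -> nat).
Hypothesis hm : forall n : nat, (0 < n)%N -> (m n)%:R = c_ n * n%:R.
Hypotheses (c_gt1 : 1 < c) (cvg_c : c_ n @[n --> \oo] --> c).

Lemma bad_arcs_rare : exists s0 : nat -> nat, forall eps : R, 0 < eps ->
  \forall n \near \oo, [/\ (m n <= #|offdiag 'I_n|)%N, (0 < log4 n)%N,
    ((1 + log4 n ^ 2 * log4 n ^ 2) * (2 * log4 n ^ 2) < s0 n)%N, (s0 n <= n)%N &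
    fraction R (m n) (@bad_arcs 'I_n (log4 n ^ 2) (s0 n) (log4 n ^ 8)) <= eps].
Proof.
have [a [b [a1 ac cb crit]]] := subcritical_window c_gt1.
have g0 := survival_gt0 a1; have g1 := survival_lt1 a.
exists (fun n => (Num.truncn (survival a * n%:R)).+1) => eps eps0.
(* Eventually [c_ n] lies between [a'] and [b']; the margins to [a] and [b] absorb the factor
   [n / (n - 1)] and the loss of [L] vertices and arcs. *)
pose a' := (a + c) / 2; pose b' := (c + b) / 2.
have aa' : a < a' by rewrite /a'; lra.
have b'b : b' < b by rewrite /b'; lra.
have ab : a <= b by lra.
have ca : \forall n \near \oo, a' < c_ n by apply: (cvgr_gt _ cvg_c); rewrite /a'; lra.
have cb' : \forall n \near \oo, c_ n < b' by apply: (cvgr_lt _ cvg_c); rewrite /b'; lra.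
pose K : R := 8 + 4 / subcrit a b + 2 * expR (2 * b).
have lin (k : R) : \forall n \near \oo, k <= n%:R by apply: nbhs_infty_ger.
near=> n.
have n2 : (2 <= n)%N by near: n; exists 2%N.
have n0 : (0 < n)%N by apply: leq_trans n2.
have l1 : (1 <= log4 n)%N by near: n; apply: log4_unbounded.
have can : a' < c_ n by near: n.
have cbn : c_ n < b' by near: n.
have nb : b' + 1 <= n%:R :> R by near: n; apply: lin.
have nbb : b / (b - b') <= n%:R :> R by near: n; apply: lin.
have nK : 2 * K / eps <= n%:R :> R by near: n; apply: lin.
have L1 : (1 + a') / (a' - a) * (log4 n)%:R ^+ 2 <= n%:R.
  by near: n; apply: log4_sublinear.
have L2 : 2 * (log4 n)%:R ^+ 2 <= n%:R :> R by near: n; apply: log4_sublinear.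
have L3 : 4 / survival a * (log4 n)%:R ^+ 6 <= n%:R by near: n; apply: log4_sublinear.
have le_eps : 8 / eps <= (log4 n)%:R.
  have : ((Num.truncn (8 / eps)).+1 <= log4 n)%N by near: n; apply: log4_unbounded.
  by rewrite -(ler_nat R); apply: le_trans; rewrite ltW // truncnS_gt.
have h1 : n%:R ^+ 5 * gap_rate a ^+ (log4 n ^ 2) <= 1.
  near: n; apply: pow_mul_rate_le1; first exact/ltW/gap_rate_gt0.
  exact: (gap_rate_lt1 a1 ab crit).
have h2 : n%:R ^+ 7 * link_rate a b ^+ (log4 n ^ 2) <= 1.
  near: n; apply: pow_mul_rate_le1; first exact/ltW/(link_rate_gt0 a1 ab).
  exact: (link_rate_lt1 crit).
have h3 : n%:R ^+ 2 * 2^-1 ^+ (log4 n ^ 2) <= 1 :> R.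
  by near: n; apply: pow_mul_rate_le1; lra.
have x0 : 0 < n%:R :> R by rewrite ltr0n.
have x1 : 2 <= n%:R :> R by rewrite ler_nat.
have x1' : 1 < n%:R :> R by rewrite ltr1n.
have predn : n.-1%:R = n%:R - 1 :> R by rewrite -subn1 natrB.
have NE : #|offdiag 'I_n|%:R = n%:R * (n%:R - 1) :> R.
  by rewrite card_offdiag_ord natrM predn.
have N0 : (0 < #|offdiag 'I_n|)%N by rewrite -(ltr0n R) NE mulr_gt0 // subr_gt0.
have mE := hm n0.
have mN : (m n <= #|offdiag 'I_n|)%N.
  by rewrite -(ler_nat R) mE NE mulrC ler_wpM2l ?(ltW x0) // (le_trans (ltW cbn)) // lerBrDr.
have lm : (n < m n)%N.
  by rewrite -(ltr_nat R) mE ltr_pMl // (lt_trans a1) // (lt_trans aa').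
have ln : (log4 n ^ 2 < n)%N.
  rewrite -(ltr_nat R) natrX; apply: lt_le_trans L2.
  by rewrite ltr_pMl ?exprn_gt0 ?ltr0n // ltr1n.
have s0g s : (s < (Num.truncn (survival a * n%:R)).+1)%N = (s%:R <= survival a * n%:R).
  by rewrite ltnS truncn_ge_nat // mulr_ge0 // ltW.
have npE : n%:R * ((m n)%:R / #|offdiag 'I_n|%:R) = c_ n * n%:R / (n%:R - 1) :> R.
  rewrite mE NE invfM [c_ n * _ * (_ * _)]mulrA mulfK ?gt_eqF //.
  by rewrite mulrA [n%:R * _]mulrC.
split => //.
(* With [L = l ^ 2 >= 1], [(1 + L ^ 2) * (2 * L)] is at most [4 * L ^ 3]. *)
- rewrite s0g; apply: le_trans (_ : (4 * log4 n ^ 6)%:R <= _).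
    have e6 : (log4 n ^ 6 = (log4 n ^ 2) ^ 3)%N by rewrite -expnM.
    rewrite ler_nat e6.
    have L0 : (0 < log4 n ^ 2)%N by rewrite expn_gt0 l1.
    move: (log4 n ^ 2)%N L0 => L L0.
    apply: leq_trans (_ : (2 * (L * L)) * (2 * L) <= _)%N.
      by apply: leq_mul => //; rewrite mul2n -addnn leq_add2r muln_gt0 L0.
    by rewrite (_ : (2 * (L * L) * (2 * L) = 4 * L ^ 3)%N) //; ring.
  rewrite natrM natrX; apply: le_trans (ler_wpM2l (ltW g0) L3).
  by rewrite [leRHS]mulrA [survival a * _]mulrCA divff ?gt_eqF // mulr1.
- by rewrite truncn_lt_nat ?mulr_ge0 ?(ltW g0) // gtr_pMl.
apply: le_trans (fraction_bad_le N0 mN a1 ab crit _ _ _ _ _ _ _ _ _ _ _) _;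
  rewrite ?card_ord //.
- by rewrite npE density_ge // ?(ltW (lt_trans aa' can)) // (le_trans ler01 (ltW a1)).
- by rewrite npE (density_le (ltW cbn) b'b nbb).
- exact: ltn_trans lm.
- exact: ltnW.
- rewrite NE !natrB ?mE; [|exact: ltnW (ltn_trans ln lm)|exact: ltnW].
  by rewrite natrX (density_shrunk_ge _ aa' (ltW can)) ?exprn_ge0 // (le_trans ler01 (ltW a1)).
have l0 : 0 < (log4 n)%:R :> R by rewrite ltr0n.
have K2 : K / n%:R <= eps / 2.
  by rewrite ler_pdivrMr // mulrAC ler_pdivlMr // [leRHS]mulrC -ler_pdivrMr // [K * 2]mulrC.
have l2 : 4 / (log4 n)%:R <= eps / 2.
  rewrite ler_pdivrMr // mulrAC ler_pdivlMr // [leRHS]mulrC -ler_pdivrMr //.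
  by rewrite -natrM.
by rewrite [leRHS](splitr eps) lerD.
Unshelve. all: by end_near. Qed.

End Limit.

Theorem theorem1p2 (R : realType) (c : R) (c_ : nat -> R) (m : nat -> nat)
    (hm : forall n : nat, (0 < n)%N -> (m n)%:R = c_ n * n%:R)
    (hc : 1 < c) (hcn : c_ n @[n --> \oo] --> c) :
  Pr_D R (m n) (fun G : digraph 'I_n =>
      [forall K : digraph 'I_n, forall H : digraph 'I_n,
        (is_core11 G K && largest_strong_component G H) ==>
        [&& 0 <= #|vertices K|%:R - #|vertices H|%:R :> R,
            #|vertices K|%:R - #|vertices H|%:R <= 2 * ln (n%:R : R) ^+ 8,
            0 <= #|arcs K|%:R - #|arcs H|%:R :> R &
            #|arcs K|%:R - #|arcs H|%:R <= 4 * ln (n%:R : R) ^+ 10]])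
    @[n --> \oo] --> (1 : R).
Proof.
have [s0 rare] := bad_arcs_rare hm hc hcn.
apply/cvgrPdist_le => eps eps0; near=> n.
have n0 : (0 < n)%N by near: n; exists 1%N.
have [mN l0 s0L s0n frac] : [/\ (m n <= #|offdiag 'I_n|)%N, (0 < log4 n)%N,
    ((1 + log4 n ^ 2 * log4 n ^ 2) * (2 * log4 n ^ 2) < s0 n)%N, (s0 n <= n)%N &
    fraction R (m n) (@bad_arcs 'I_n (log4 n ^ 2) (s0 n) (log4 n ^ 8)) <= eps].
  by near: n; apply: rare.
set E := (fun G : digraph 'I_n => _).
suff good G : vertices G = [set: 'I_n]%SET ->
    ~~ bad_arcs (log4 n ^ 2) (s0 n) (log4 n ^ 8) (arcs G) -> E G.
  have /andP[lo hi] := Pr_D_bounds R mN good.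
  by rewrite ger0_norm ?subr_ge0 // lerBlDr addrC -lerBlDr (le_trans _ lo) // lerD2l lerN2.
move=> GT goodG; apply/forallP=> K; apply/forallP=> H; apply/implyP=> /andP[cK lH].
have L0 : (0 < log4 n ^ 2)%N by rewrite expn_gt0 l0.
have s0T : (s0 n <= #|'I_n|)%N by rewrite card_ord.
have [V1 V2 A1 A2] := good_core_close GT goodG L0 s0L s0T cK lH.
(* With [L = l ^ 2] and [M = l ^ 8] the deterministic errors [2 * M] and [4 * M * L] are [2 l ^ 8]
   and [4 l ^ 10], and [l <= ln n]. *)
have ln0 := log4_le_ln R n0.
have ln_pow d : (log4 n)%:R ^+ d <= ln (n%:R : R) ^+ d.
  by rewrite lerXn2r ?nnegrE // (le_trans _ ln0).
rewrite -!(ler_nat R) in V1 V2 A1 A2.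
apply/and4P; split; rewrite ?subr_ge0 //.
  rewrite lerBlDl (le_trans V2) // natrD lerD2l natrM natrX.
  by rewrite ler_wpM2l.
rewrite lerBlDl (le_trans A2) // natrD lerD2l -mulnA -expnD natrM natrX.
by rewrite ler_wpM2l.
Unshelve. all: by end_near. Qed.
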